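(* Let $\Phi=(V,\mathbf{Q},C)$ be a CSP formula with $|\mathsf{vbl}(c)|=k$ for all $c\in C$ and every variable in at most $\Delta$ constraints. Fix a projection $\mathbf{f}=(f_v)_{v\in V}$, $f_v:Q_v\to\Sigma_v$, a distinguished symbol $1^\blacktriangle$ and $\lambda\in\mathbb{C}$. Write $C=\{c_1,\dots,c_m\}$ and $\Phi_i=(V,\mathbf{Q},\{c_1,\dots,c_i\})$ for $0\le i\le m$. Suppose $$Z_0=\prod_{v\in V}\sum_{a\in Q_v}\Big(\mathbb{I}[f_v(a)\neq1^\blacktriangle]+\lambda\,\mathbb{I}[f_v(a)=1^\blacktriangle]\Big)\neq0,$$ and for every $1\le i\le m$, the formula $\Phi_i$ with distinguished constraint $c_i$ satisfies Condition $(\star)$ with $K=k$. Then $Z(\Phi)\neq0$.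
   Context: A CSP formula $\Psi=(V,\mathbf{Q},D)$ has finite variable set $V$, finite domains $\mathbf{Q}=(Q_v)_{v\in V}$, and constraints $D$; each $c\in D$ has scope $\mathsf{vbl}(c)\subseteq V$ and a set $c^{-1}(\mathrm{False})\subseteq\bigotimes_{v\in\mathsf{vbl}(c)}Q_v$ of violating partial assignments. $\Omega_\Psi$ is the set of full assignments violating no constraint. Given $\mathbf{f}$, $1^\blacktriangle$, $\lambda$: for $\sigma\in\Omega_\Psi$, $w(\sigma)=\lambda^{|\{v:f_v(\sigma_v)=1^\blacktriangle\}|}$ and $Z(\Psi)=\sum_{\sigma\in\Omega_\Psi}w(\sigma)$. When $Z(\Psi)\ne0$, $\mu=w/Z(\Psi)$ and the projected measure on $\mathbf{\Sigma}=\bigotimes_v\Sigma_v$ is $\psi(\tau)=\sum_{\sigma\in\Omega_\Psi:\,(f_v(\sigma_v))_v=\tau}\mu(\sigma)$. For $\Lambda\subseteq V$ and $\tau\in\mathbf{\Sigma}_\Lambda=\bigotimes_{v\in\Lambda}\Sigma_v$, $\psi(\tau)$ is the sum of $\psi(\tau')$ over $\tau'\in\mathbf\Sigma$ agreeing with $\tau$ on $\Lambda$; $\tau$ is extendable if it agrees on $\Lambda$ with some $\tau'$ with $\psi(\tau')\neq0$; $\mathcal{F}_\Lambda$ denotes the set of extendable $\tau\in\mathbf\Sigma_\Lambda$. For $u\in V$, $\tau\in\mathcal F_{V\setminus\{u\}}$ with $\psi(\tau)\ne0$, $\psi_u^\tau(x)=\psi(\tau\wedge x)/\psi(\tau)$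 for $x\in\Sigma_u$ (well-defined iff $\psi(\tau)\neq0$). Condition $(\star)$ for a formula $\Psi=(V,\mathbf Q,D)$ in which every constraint has exactly $K$ variables and every variable lies in at most $\Delta$ constraints, with distinguished $c^*\in D$: let $\Psi^-=(V,\mathbf Q,D\setminus\{c^*\})$. If $Z(\Psi^-)\neq0$, then, with $\psi$ the projected measure of $\Psi^-$: (i) for every $u\in V$ and every $\tau\in\mathcal F_{V\setminus\{u\}}$, $\psi^\tau_u$ is well-defined; (ii) there exist, for each $u\in V$, complex numbers $b_u(x)$, $x\in\Sigma_u\cup\{\bot\}$, with $\sum_x b_u(x)=1$, such that, setting $\psi_u^{\tau,\bot}(x)=(\psi_u^\tau(x)-b_u(x))/b_u(\bot)$ and $R_u=|b_u(\bot)|\max_{\tau\in\mathcal F_{V\setminus\{u\}}}\sum_{x\in\Sigma_u}|\psi_u^{\tau,\bot}(x)|$ (with $R_u=0$ when $b_u(\bot)=0$), $\widehat N=\max_{c\in D}\sum_{\sigma\in c^{-1}(\mathrm{False})}\prod_{u\in\mathsf{vbl}(c)}\big(|b_u(f_u(\sigma_u))|+R_u\big)$ and $\widehat M=\max_{u\in V}\big(\sum_{x\in\Sigma_u}|b_u(x)|+R_u\big)$ satisfy $4e\Delta^2K^4\,\widehat N\,\widehat M^{4\Delta^2K^5}\le\frac14$.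
   Formalization: The formal theorem assumes k ≥ 1, and in Condition (⋆) it requires ψ_u^τ = b_u for all extendable τ whenever b_u(⊥) = 0; without either clause the literal claim has counterexamples. *)

(* Defs.v *)
From HB Require Import structures.
From mathcomp Require Import all_boot all_order all_algebra.
From mathcomp Require Import reals sequences exp complex.

Set Implicit Arguments.
Unset Strict Implicit.
Unset Printing Implicit Defensive.

Import Order.TTheory GRing.Theory Num.Theory.
Local Open Scope ring_scope.
Local Open Scope complex_scope.

Section Assignments.
Variables (V : finType) (T : V -> finType).

Definition assignment : finType := {dffun forall v : V, T v}.

Definition passignment (L : {set V}) : finType :=
  {dffun forall v : {v : V | v \in L}, T (val v)}.

Definition restrict (L : {set V}) (s : assignment) : passignment L :=
  [ffun v : {v : V | v \in L} => s (val v)].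

(* A constraint is its scope together with the set of assignments of that
   scope that violate it. *)
Definition constraint : finType := {L : {set V} & {set passignment L}}.

Definition vbl (c : constraint) : {set V} := tag c.

Definition violating (c : constraint) : {set passignment (vbl c)} := tagged c.

(* On fixed V and T, a CSP formula is its set of constraints. *)
Definition solutions (D : {set constraint}) : {set assignment} :=
  [set s | [forall c in D, restrict (vbl c) s \notin violating c]].

End Assignments.

(* The alphabets Sigma_v are subsets of a common finite set A of symbols, so
   that the distinguished symbol may belong to some of them and not others. *)
Definition symbol (V A : finType) (Sig : V -> {set A}) (v : V) : finType :=
  {a : A | a \in Sig v}.

Section Projection.
Variables (R : realType) (V : finType) (Q : V -> finType).
Variables (A : finType) (Sig : V -> {set A}).
Variables (f : forall v, Q v -> symbol Sig v) (one : A) (lambda : R[i]).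
Implicit Types (D : {set constraint Q}) (u v : V).

Definition project (s : assignment Q) : assignment (symbol Sig) :=
  [ffun v => f (s v)].

Definition weight (s : assignment Q) : R[i] :=
  lambda ^+ #|[set v | val (f (s v)) == one]|.

Definition Z D : R[i] := \sum_(s in solutions D) weight s.

Definition mu D (s : assignment Q) : R[i] := weight s / Z D.

Definition psi D (t : assignment (symbol Sig)) : R[i] :=
  \sum_(s in solutions D | project s == t) mu D s.

Definition psi_on D (L : {set V}) (t : passignment (symbol Sig) L) : R[i] :=
  \sum_(t' | restrict L t' == t) psi D t'.

Definition extendable D (L : {set V}) : {set passignment (symbol Sig) L} :=
  [set t | [exists t', (restrict L t' == t) && (psi D t' != 0)]].

(* The numerator is psi (t /\ x): the sum below has exactly one term, namely
   the extension of t by the value x at u. *)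
Definition psi_cond D u (t : passignment (symbol Sig) [set~ u])
    (x : symbol Sig u) : R[i] :=
  (\sum_(t' | (restrict [set~ u] t' == t) && (t' u == x)) psi D t')
    / psi_on D t.

Section Decomposition.
(* [None] is the extra symbol bot. *)
Variables (b : forall u, option (symbol Sig u) -> R[i]).
Arguments b : clear implicits.

Definition psi_bot D u (t : passignment (symbol Sig) [set~ u])
    (x : symbol Sig u) : R[i] :=
  (psi_cond D t x - b u (Some x)) / b u None.

Definition Rbound D u : R :=
  if b u None == 0 then 0 else
  Normc.normc (b u None) *
    \big[Num.max/0]_(t in extendable D [set~ u])
      \sum_(x : symbol Sig u) Normc.normc (psi_bot D t x).

(* The constraints range over D, while the Rbound u are those of D'. *)
Definition Nhat D D' : R :=
  \big[Num.max/0]_(c in D) \sum_(s in violating c)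
    \prod_(u : {v : V | v \in vbl c})
      (Normc.normc (b (val u) (Some (f (s u)))) + Rbound D' (val u)).

Definition Mhat D' : R :=
  \big[Num.max/0]_(u : V)
    (\sum_(x : symbol Sig u) Normc.normc (b u (Some x)) + Rbound D' u).

(* When b_u(bot) = 0 the quotient defining psi_bot makes sense only if its
   numerator vanishes, i.e. psi_u^t = b_u + b_u(bot) psi_u^{t,bot} forces
   psi_u^t = b_u for every extendable t. *)
Definition decomposes D : Prop :=
  forall u, b u None = 0 ->
  forall t, t \in extendable D [set~ u] ->
  forall x, psi_cond D t x = b u (Some x).

End Decomposition.

Definition condition_star (K Delta : nat) D (cstar : constraint Q) : Prop :=
  let D' := D :\ cstar in
  Z D' != 0 ->
  (forall u (t : passignment (symbol Sig) [set~ u]),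
     t \in extendable D' [set~ u] -> psi_on D' t != 0) /\
  exists b : forall u, option (symbol Sig u) -> R[i],
    [/\ forall u, \sum_x b u x = 1,
        decomposes b D' &
        4 * expR 1 * Delta%:R ^+ 2 * K%:R ^+ 4 * Nhat b D D'
          * Mhat b D' ^+ (4 * Delta ^ 2 * K ^ 5) <= 4^-1 :> R].

End Projection.

Definition prefix_formula (V : finType) (Q : V -> finType) (m : nat)
    (c : 'I_m -> constraint Q) (i : nat) : {set constraint Q} :=
  [set c j | j : 'I_m & (j < i)%N].

(* Main.v *)
(** By induction on [i]: if [D = D' + c], then [Z D = Z D' * (1 - psi g)], where
    [psi] is the projected measure of [D'] and [g t], a number in [[0, 1]], is the
    proportion of the solutions of [D'] above [t] that violate [c].  It suffices
    to prove [|psi g| < 1].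

    The complex measure [psi] is stationary for the systematic scan that resamples
    [u] from [psi_u^t = b_u + b_u(bot) psi_u^{t,bot}].  First draw, independently
    of everything, the outcome [r] of each update in [Sigma_u + bot] with complex
    weights [b_u]; the updates drawn as [bot] are then resolved with
    [psi_u^{t,bot}].  Call an instance of a constraint (a constraint and the latest
    updates of its variables at some time) bad if [r] does not exclude that it is
    violated.  If the final instance of [c] is not bad, [g = 0].  Otherwise the
    contribution of [r] depends only on the values of [r] near the cluster of bad
    instances around it, so that all other updates sum to 1 exactly, without
    absolute values.  The cluster is dominated by a 2-tree [T] of pairwise disjoint
    bad instances; a given [T] contributes at most
    [(N * M ^ (Delta^2 k^5)) ^ #|T|], and the trees are counted by comparison with
    Bernoulli percolation.  Trees large enough to reach the initial state
    contribute a vanishing amount as the number of rounds grows.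

    An oblivious update may leave the set of extendable states, where
    [psi_u^{t,bot}] makes no sense.  There it is replaced by its value at an
    extendable state which agrees with [t] locally around [u]. *)

Require Import Defs.
From HB Require Import structures.
From mathcomp Require Import all_boot all_order all_algebra.
From mathcomp Require Import reals sequences exp complex.
From mathcomp Require Import boolp zify ring lra.

Set Implicit Arguments.
Unset Strict Implicit.
Unset Printing Implicit Defensive.

Import Order.TTheory GRing.Theory Num.Theory.
Local Open Scope ring_scope.
Local Open Scope complex_scope.

(** * Sums of products *)

Section ProductSums.

Variables (X B : finType).
Implicit Types (r q : {ffun X -> B}) (S : {pred X}).

Definition splice S r q : {ffun X -> B} := [ffun x => if x \in S then r x else q x].

Lemma spliceK S r q : splice S (splice S r q) (splice S q r) = r.
Proof. by apply/ffunP => x; rewrite !ffunE; case: ifP => // ->. Qed.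

(** By hypothesis [(y, z) -> (mg y z, mg z y)] is an involution of pairs, hence a reindexing of the
    double sum. *)
Lemma sum_swap (C : nmodType) (Y : finType) (mg : Y -> Y -> Y) (G : Y -> Y -> C) :
  (forall y z, mg (mg y z) (mg z y) = y) ->
  \sum_y \sum_z G y z = \sum_y \sum_z G (mg y z) (mg z y).
Proof.
move=> mgK; rewrite !pair_bigA /=.
rewrite (reindex_inj (h := fun p : Y * Y => (mg p.1 p.2, mg p.2 p.1))) //.
by apply: inv_inj => -[y z] /=; rewrite !mgK.
Qed.

Lemma sum_prod1 (C : comPzRingType) (b : X -> B -> C) :
  (forall x, \sum_y b x y = 1) ->
  \sum_(r : {ffun X -> B}) \prod_x b x (r x) = 1.
Proof. by move=> b1; rewrite -bigA_distr_bigA big1. Qed.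

Lemma sum_prod_coord (C : comPzRingType) (b : X -> B -> C) (x0 : X) (h : B -> C) :
  (forall x, x != x0 -> \sum_y b x y = 1) ->
  \sum_(r : {ffun X -> B}) (\prod_x b x (r x)) * h (r x0) = \sum_y b x0 y * h y.
Proof.
move=> b1.
transitivity (\sum_(r : {ffun X -> B})
    \prod_x (b x (r x) * (if x == x0 then h (r x) else 1))).
  apply: eq_bigr => r _; rewrite big_split /=; congr (_ * _).
  by rewrite (bigD1 x0) //= eqxx big1 ?mulr1 // => x /negPf->.
rewrite -(bigA_distr_bigA (fun x y => b x y * (if x == x0 then h y else 1))).
rewrite (bigD1 x0) //= eqxx [X in _ * X]big1 ?mulr1 // => x xx0.
by rewrite (negPf xx0); under eq_bigr do rewrite mulr1; apply: b1.
Qed.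

(** Draw an independent [q] with weights [b'] and exchange [r] and [q] off [S]. [F] does not notice,
    and the two families of weights trade places. *)
Lemma sum_prod_resample (C : comPzRingType) (b b' : X -> B -> C) S
    (F : {ffun X -> B} -> C) :
  (forall x, \sum_y b x y = 1) -> (forall x, \sum_y b' x y = 1) ->
  (forall x, x \in S -> b x =1 b' x) ->
  (forall r q, (forall x, x \in S -> r x = q x) -> F r = F q) ->
  \sum_(r : {ffun X -> B}) (\prod_x b x (r x)) * F r =
  \sum_(r : {ffun X -> B}) (\prod_x b' x (r x)) * F r.
Proof.
move=> b1 b'1 bb' FS.
transitivity (\sum_(r : {ffun X -> B}) \sum_(q : {ffun X -> B})
    (\prod_x b x (r x)) * F r * \prod_x b' x (q x)).
  by apply: eq_bigr => r _; rewrite -big_distrr /= sum_prod1 ?mulr1.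
rewrite (sum_swap _ (spliceK S)) /=.
apply: eq_bigr => r _.
transitivity (\sum_(q : {ffun X -> B})
    (\prod_x b' x (r x)) * F r * \prod_x b x (q x)); last first.
  by rewrite -big_distrr /= sum_prod1 ?mulr1.
apply: eq_bigr => q _.
rewrite (FS (splice S r q) r); last by move=> x xS; rewrite ffunE xS.
rewrite mulrAC [RHS]mulrAC -!big_split /=; congr (_ * _).
apply: eq_bigr => x _; rewrite !ffunE.
by case: ifP => [xS|_]; [rewrite !bb' //| rewrite mulrC].
Qed.

(** Turns an explicit average over a value at [x0] into the reading of the coordinate [x0] of the
    sample itself, by exchanging that coordinate with a fresh copy. *)
Lemma sum_prod_average (C : comPzRingType) (b : X -> B -> C) (x0 : X)
    (F G : {ffun X -> B} -> C) (H : B -> {ffun X -> B} -> C) :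
  (forall x, \sum_y b x y = 1) ->
  (forall r, F r = \sum_y b x0 y * H y r) ->
  (forall r q, G (splice (predC1 x0) r q) = H (q x0) r) ->
  \sum_(r : {ffun X -> B}) (\prod_x b x (r x)) * F r =
  \sum_(r : {ffun X -> B}) (\prod_x b x (r x)) * G r.
Proof.
move=> b1 FE GE.
transitivity (\sum_(r : {ffun X -> B}) \sum_(q : {ffun X -> B})
    (\prod_x b x (r x)) * G r * \prod_x b x (q x)); last first.
  by apply: eq_bigr => r _; rewrite -big_distrr /= sum_prod1 ?mulr1.
rewrite (sum_swap _ (spliceK (predC1 x0))) /=.
apply: eq_bigr => r _.
transitivity (\sum_(q : {ffun X -> B})
    (\prod_x b x (r x)) * ((\prod_x b x (q x)) * H (q x0) r)).
  by rewrite -big_distrr /= (sum_prod_coord (H^~ r)) -?FE.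
apply: eq_bigr => q _; rewrite GE [in RHS]mulrAC mulrA -!big_split /=.
congr (_ * _); apply: eq_bigr => x _; rewrite !ffunE.
by case: ifP => // _; rewrite mulrC.
Qed.

(* Each event is dominated by a sum of product functions of its own block, so
   that disjointness of the blocks lets the events be integrated one by one. *)
Lemma sum_prod_disjoint (C : numDomainType) (E : eqType) (J : E -> finType)
    (D : E -> {set X}) (P : E -> {ffun X -> B} -> bool)
    (vio : forall e, pred (J e)) (phi : forall e, J e -> X -> B -> bool) (N : C)
    (w : X -> B -> C) (s : seq E) :
  (forall x y, 0 <= w x y) -> 0 <= N -> uniq s ->
  (forall e r, P e r -> exists2 j, vio e j & forall x, x \in D e -> phi e j x (r x)) ->
  (forall e, e \in s ->
     \sum_(j | vio e j) \prod_(x in D e) \sum_y w x y * (phi e j x y)%:R <= N) ->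
  {in s &, forall e e', e != e' -> [disjoint D e & D e']} ->
  \sum_(r : {ffun X -> B}) (\prod_x w x (r x)) * (all (P^~ r) s)%:R
    <= N ^+ size s * \prod_(x | x \notin \bigcup_(e <- s) D e) \sum_y w x y.
Proof.
move=> w0 N0 + PE; elim: s w w0 => [|e s IH] w w0 /= us HN dis.
  rewrite expr0 mul1r [leRHS](eq_bigl xpredT) => [|x]; last by rewrite big_nil inE.
  by rewrite bigA_distr_bigA; apply: ler_sum => r _; rewrite mulr1.
have /andP[es us'] := us.
(* The pattern [j] of the head event is absorbed into the weights of its block; hence the
   generalisation over [w] in the induction. *)
pose w' j x y := if x \in D e then w x y * (phi e j x y)%:R else w x y.
have w'0 j x y : 0 <= w' j x y by rewrite /w'; case: ifP => // _; rewrite mulr_ge0.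
apply: (@le_trans _ _ (\sum_(j | vio e j)
    \sum_(r : {ffun X -> B}) (\prod_x w' j x (r x)) * (all (P^~ r) s)%:R)).
  rewrite exchange_big /=; apply: ler_sum => r _.
  case: (boolP (P e r)) => [Per|]; last first.
    move=> _; rewrite mulr0; apply: sumr_ge0 => j _.
    by rewrite mulr_ge0 // prodr_ge0.
  have [j vj Hj] := PE _ _ Per.
  rewrite (bigD1 j) //= -[leLHS]addr0 lerD //; last first.
    by apply: sumr_ge0 => j' _; rewrite mulr_ge0 // prodr_ge0.
  rewrite ler_wpM2r //; apply: ler_prod => x _; rewrite w0 /= /w'.
  by case: ifP => // xD; rewrite Hj // mulr1.
have dise x e' : e' \in s -> x \in D e' -> (x \in D e) = false.
  move=> e's xe'; apply/negbTE.
  have ne : e' != e by apply: contraNneq es => <-.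
  have := dis e' e; rewrite !inE e's eqxx orbT ne => /(_ isT isT isT).
  by move/disjointFr => ->.
have step j : vio e j -> \sum_(r : {ffun X -> B}) (\prod_x w' j x (r x)) * (all (P^~ r) s)%:R <=
    N ^+ size s * ((\prod_(x in D e) \sum_y w x y * (phi e j x y)%:R) *
      \prod_(x | x \notin \bigcup_(e <- e :: s) D e) \sum_y w x y).
  move=> vj; apply: (le_trans (IH (w' j) _ us' _ _)) => //.
  - move=> e' e's; rewrite (le_trans _ (HN e' _)) ?inE ?e's ?orbT //.
    apply: ler_sum => j' _; apply: ler_prod => x xe'.
    apply/andP; split; first by apply: sumr_ge0 => y _; rewrite mulr_ge0.
    by apply: ler_sum => y _; rewrite /w' (dise x e').
  - by move=> e1 e2 e1s e2s; apply: dis; rewrite inE ?e1s ?e2s orbT.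
  rewrite ler_wpM2l ?exprn_ge0 //.
  rewrite (bigID (mem (D e))) /= le_eqVlt; apply/orP; left; apply/eqP.
  congr (_ * _).
    apply: eq_big => [x|x /andP[_ xe]]; last first.
      by apply: eq_bigr => y _; rewrite /w' xe.
    case: (boolP (x \in D e)) => xe; rewrite ?andbF // andbT.
    rewrite big_seq.
    elim/big_ind: _ => [|A1 A2 h1 h2|e' e's]; first by rewrite inE.
      by rewrite inE negb_or h1.
    by apply: contraL xe => /(dise _ _ e's) ->.
  apply: eq_big => [x|x /andP[_ /negPf xe]]; last first.
    by apply: eq_bigr => y _; rewrite /w' xe.
  by rewrite big_cons inE negb_or andbC.
apply: (le_trans (ler_sum _ step)).
rewrite -big_distrr /= -big_distrl /= exprSr -mulrA ler_wpM2l ?exprn_ge0 //.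
rewrite ler_wpM2r ?HN ?inE ?eqxx //.
by apply: prodr_ge0 => x _; apply: sumr_ge0.
Qed.

End ProductSums.
(** * Clusters and 2-trees *)

Lemma leq_card_bigcup (I X : finType) (P : pred I) (F : I -> {set X}) :
  (#|\bigcup_(i | P i) F i| <= \sum_(i | P i) #|F i|)%N.
Proof.
elim/big_rec2: _ => [|i n A _ le]; first by rewrite cards0.
by rewrite (leq_trans (leq_card_setU _ _)) // leq_add2l.
Qed.

Section Clusters.

Variables (E : finType) (e0 : E).
Implicit Types (R : rel E) (T B : {set E}).

(** Only the endpoint of a step has to lie in [T], so the root always belongs to its cluster. Thus
    [cluster R T = T] says that [T] contains the root and is reachable from it inside [T]. *)
Definition cluster R T : {set E} :=
  [set y | connect [rel x y | R x y && (y \in T)] e0 y].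

Lemma cluster_ind R T (S : E -> Prop) :
  S e0 -> (forall x y, S x -> R x y -> y \in T -> S y) ->
  forall y, y \in cluster R T -> S y.
Proof.
move=> S0 IH y; rewrite inE => /connectP[p]; elim/last_ind: p y => [|p x IHp] y.
  by move=> _ ->.
rewrite rcons_path last_rcons /= => /andP[pp /andP[Rx xT]] ->.
exact: IH (IHp _ pp erefl) Rx xT.
Qed.

Lemma cluster_root R T : e0 \in cluster R T.
Proof. by rewrite inE. Qed.

Lemma cluster_step R T x y : x \in cluster R T -> R x y -> y \in T -> y \in cluster R T.
Proof.
rewrite !inE => ex Rxy yT; apply: connect_trans ex (connect1 _).
by rewrite /= Rxy.
Qed.

Lemma clusterS R T T' : T \subset T' -> cluster R T \subset cluster R T'.
Proof.
move=> TT'; apply/subsetP; apply: cluster_ind; first exact: cluster_root.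
by move=> x y xT' Rxy /(subsetP TT') yT'; exact: cluster_step xT' Rxy yT'.
Qed.

Lemma cluster_sub R T : e0 \in T -> cluster R T \subset T.
Proof. by move=> eT; apply/subsetP; apply: (@cluster_ind R T (fun y => y \in T)). Qed.

Lemma clusterK R T : e0 \in T -> cluster R (cluster R T) = cluster R T.
Proof.
move=> eT; apply/eqP; rewrite eqEsubset clusterS ?cluster_sub //=.
apply/subsetP => y yT.
have : (y \in cluster R T) && (y \in cluster R (cluster R T)); last by case/andP.
move: y yT; apply: (cluster_ind (S := fun y =>
  (y \in cluster R T) && (y \in cluster R (cluster R T)))).
  by rewrite !cluster_root.
move=> x y /andP[xT xT'] Rxy yT.
by rewrite (cluster_step xT Rxy yT) (cluster_step xT' Rxy) // (cluster_step xT Rxy yT).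
Qed.

(** A repetition-free path from the root inside [T] has at most [#|T|] steps, and each raises [h] by
    at most [l]. *)
Lemma cluster_range R T (h : E -> nat) (l : nat) :
  (forall x y, R x y -> (h y <= h x + l)%N) -> cluster R T = T ->
  forall y, y \in T -> (h y <= h e0 + l * #|T|)%N.
Proof.
move=> Rh TE y; rewrite -{1}TE inE => /connectP[p0 /shortenP[p]].
move=> pp /= /andP[_ up] _ ->.
have pT : {subset p <= T}.
  elim/last_ind: {up} p pp => [|p x IH] //.
  rewrite rcons_path => /andP[/IH pT /= /andP[_ xT]] z.
  by rewrite mem_rcons inE => /predU1P[->|/pT].
apply: (@leq_trans (h e0 + l * size p)); last first.
  by rewrite leq_add2l leq_mul2l cardE uniq_leq_size ?orbT // => z /pT; rewrite mem_enum.
elim/last_ind: p pp {up pT} => [|p x IH]; first by rewrite muln0 addn0.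
rewrite rcons_path last_rcons size_rcons /= => /andP[/IH le1 /andP[/Rh le2 _]].
by rewrite mulnS addnCA addnC (leq_trans le2) // leq_add2r.
Qed.

(* In Bernoulli percolation the events "the cluster of [e0] is [T]" are
   disjoint, and each has probability at least [(p (1 - p) ^ d) ^ #|T|]. *)
Lemma sum_clusters (C : numDomainType) R (d : nat) (p : C) :
  0 <= p <= 1 -> (forall x, #|[set y | R x y]| <= d)%N ->
  \sum_(T : {set E} | cluster R T == T) (p * (1 - p) ^+ d) ^+ #|T| <= 1.
Proof.
move=> /andP[p0 p1] Rd; have q0 : 0 <= 1 - p by rewrite subr_ge0.
pose wt (W : {set E}) : C := \prod_x (if x \in W then p else 1 - p).
have wt0 W : 0 <= wt W by apply: prodr_ge0 => x _; case: ifP.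
have wt1 : \sum_(W : {set E}) wt W = 1.
  by rewrite -bigA_distr big1 // => x _; rewrite /= addrC subrK.
(* If [W] contains [T] and avoids its outer boundary [bd T], exploring [W] from the root stops
   exactly at [T]. This makes the events [ev T] disjoint. *)
pose bd (T : {set E}) := (\bigcup_(x in T) [set y | R x y]) :\: T.
pose ev (T W : {set E}) := (T \subset W) && [disjoint W & bd T].
have evE T W : cluster R T == T -> ev T W -> T = cluster R W.
  move=> /eqP TE /andP[TW dis]; apply/eqP.
  rewrite eqEsubset -{1}TE clusterS //=; apply/subsetP; apply: cluster_ind.
    by rewrite -TE cluster_root.
  move=> x y xT Rxy yW; apply: contraLR (yW) => yT.
  rewrite (disjointFl dis) // inE yT; apply/bigcupP; exists x => //.
  by rewrite inE.
rewrite -[leRHS]wt1.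
apply: (@le_trans _ _ (\sum_(T | cluster R T == T) \sum_W wt W * (ev T W)%:R)).
  apply: ler_sum => T _.
  have -> : \sum_W wt W * (ev T W)%:R = p ^+ #|T| * (1 - p) ^+ #|bd T|.
    transitivity (\sum_(W : {set E}) \prod_x (if x \in W then p * (x \notin bd T)%:R
                                    else (1 - p) * (x \notin T)%:R)).
      apply: eq_bigr => W _; case: (boolP (ev T W)) => [/andP[TW dis]|].
        rewrite mulr1; apply: eq_bigr => x _; case: (boolP (x \in W)) => xW.
          by rewrite (disjointFr dis) ?mulr1.
        by rewrite (contra ((subsetP TW) x)) ?mulr1.
      rewrite mulr0 negb_and => /orP[/subsetPn[x xT xW]|/pred0Pn[x /andP[/= xW xT]]].
        by rewrite (bigD1 x) //= (negPf xW) xT mulr0 mul0r.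
      by rewrite (bigD1 x) //= xW xT mulr0 mul0r.
    rewrite -bigA_distr (bigID (mem T)) /= (bigID (mem (bd T))) /=.
    rewrite [X in X * _ * _]big1 => [|x /andP[xT]]; last by rewrite inE xT.
    rewrite mul1r (eq_bigl (mem T)) => [|x]; last first.
      by rewrite /= !inE; case: (x \in T).
    rewrite (eq_bigr (fun=> p)) => [|x /= xT]; last first.
      by rewrite !inE xT /= !mulr1 mulr0 addr0.
    rewrite prodr_const; congr (_ * _).
    rewrite (bigID (mem (bd T))) /= [X in _ * X]big1 => [|x /andP[-> ->]]; last first.
      by rewrite !mulr1; ring.
    rewrite mulr1 (eq_bigl (mem (bd T))) => [|x]; last first.
      by rewrite /= !inE; case: (x \in T).
    rewrite (eq_bigr (fun=> 1 - p)) ?prodr_const // => x /= xb; rewrite xb mulr0 add0r.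
    by move: xb; rewrite !inE => /andP[-> _]; rewrite mulr1.
  rewrite exprMn -exprM ler_wpM2l ?exprn_ge0 // ler_wiXn2l // ?gerBl //.
  apply: (leq_trans (subset_leq_card (subsetDl _ _))).
  apply: (leq_trans (leq_card_bigcup _ _)).
  rewrite mulnC -sum_nat_const; exact: leq_sum.
rewrite exchange_big /=; apply: ler_sum => W _.
rewrite -big_distrr /= -[leRHS]mulr1 ler_wpM2l //.
have [/existsP[T /andP[TE evT]]|/existsPn nT] :=
    boolP [exists T, (cluster R T == T) && ev T W].
  rewrite (bigD1 T) //= evT big1 ?addr0 // => T' /andP[TE' nTT'].
  case: (boolP (ev T' W)) => // /(evE _ _ TE') T'W.
  by rewrite T'W -(evE _ _ TE evT) eqxx in nTT'.
rewrite big1 // => T TE; move: (nT T); rewrite TE /=.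
by move/negPf->.
Qed.

Definition adj2 R : rel E := [rel x y | [exists z, R x z && R z y]].

Definition independent R T :=
  [forall x in T, forall y in T, (x != y) ==> ~~ R x y].

(* In the literature the steps of a 2-tree have length exactly 2; a step of
   length at most 2 between distinct independent points is the same thing. *)
Definition two_tree R T := (cluster (adj2 R) T == T) && independent R T.

(** A maximal 2-tree in [B] works. If a walk in [B] led from a dominated [x] to an undominated [y],
    then [y] would be non-adjacent to the tree but within two steps of it, and could be added. *)
Lemma two_tree_exists R B :
  symmetric R -> {in B, reflexive R} -> cluster R B = B ->
  exists T : {set E}, [/\ T \subset B, two_tree R T &
    forall y, y \in B -> exists2 t, t \in T & R t y].
Proof.
move=> Rsym Rrefl BE; have e0B : e0 \in B by rewrite -BE cluster_root.
pose good T := (T \subset B) && two_tree R T.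
have good0 : good [set e0].
  rewrite /good /two_tree sub1set e0B /=; apply/andP; split.
    rewrite eqEsubset cluster_sub ?inE //= sub1set; exact: cluster_root.
  by apply/forall_inP => x /set1P->; apply/forall_inP => y /set1P->; rewrite eqxx.
have [T /maxsetP[/andP[TB TT] Tmax] _] := maxset_exists good0.
exists T; split=> // y; rewrite -{1}BE.
have [/eqP TE /forall_inP indT] := andP TT.
move: y; apply: cluster_ind => [|x y [t tT Rtx] Rxy yB].
  exists e0; last exact: Rrefl.
  by rewrite -TE cluster_root.
have [/existsP[t' /andP[t'T Rt'y]]|/existsPn nT] :=
    boolP [exists t', (t' \in T) && R t' y]; first by exists t'.
have yT : y \notin T.
  by apply/negP => yT; move: (nT y); rewrite yT Rrefl.
have nadj t' : t' \in T -> ~~ R t' y by move=> t'T; move: (nT t'); rewrite t'T.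
have : y |: T = T; last by move/setP/(_ y); rewrite !inE eqxx (negPf yT).
apply: Tmax; last exact: subsetUr.
rewrite /good subUset sub1set yB TB /=; apply/andP; split.
  rewrite eqEsubset cluster_sub /=; last first.
    by rewrite !inE -TE cluster_root orbT.
  have sub : T \subset cluster (adj2 R) (y |: T) by rewrite -{1}TE clusterS ?subsetUr.
  rewrite subUset sub andbT sub1set.
  apply: (cluster_step (subsetP sub t tT)); last by rewrite !inE eqxx.
  by apply/existsP; exists x; rewrite Rtx.
apply/forall_inP => a; rewrite !inE => /predU1P[->|aT]; apply/forall_inP => b.
  rewrite !inE => /predU1P[->|bT]; first by rewrite eqxx.
  by apply/implyP => _; rewrite Rsym nadj.
rewrite !inE => /predU1P[->|bT]; first by apply/implyP => _; rewrite nadj.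
exact: (forall_inP (indT a aT)).
Qed.

End Clusters.
(** * Glauber dynamics with oblivious updates *)

Section Scan.

Variables (V : finType) (v0 : V).

(* Time runs backwards: the update of age [p] is followed by those of ages
   [p - 1, ..., 0].  The window of length [#|V|] starting at [m] contains the
   latest update of every variable before the updates of age less than [m];
   that of [v] has age [age m v]. *)
Definition site (p : nat) : V := nth v0 (enum V) (p %% #|V|).

Definition age (m : nat) (v : V) : nat :=
  (m + index v [seq site (m + i) | i <- iota 0 #|V|])%N.

Lemma cardV_gt0 : (0 < #|V|)%N.
Proof. by apply/card_gt0P; exists v0. Qed.

Lemma site_window m v : exists2 i, (i < #|V|)%N & site (m + i) = v.
Proof.
have n0 := cardV_gt0.
have jn : (index v (enum V) < #|V|)%N by rewrite cardE index_mem mem_enum.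
(* The offset that moves [m] to the residue of [v]; adding [#|V|] keeps the truncated subtraction
   exact. *)
exists ((index v (enum V) + #|V| - m %% #|V|) %% #|V|)%N; first by rewrite ltn_mod.
rewrite /site modnDmr.
have -> : (m + (index v (enum V) + #|V| - m %% #|V|) =
           (m %/ #|V|).+1 * #|V| + index v (enum V))%N.
  have := ltn_pmod m n0; have := divn_eq m #|V|; rewrite mulSn; lia.
by rewrite modnMDl modn_small // nth_index ?mem_enum.
Qed.

Lemma site_inj m p q : (m <= p < m + #|V|)%N -> (m <= q < m + #|V|)%N ->
  site p = site q -> p = q.
Proof.
have n0 := cardV_gt0.
move=> /andP[mp pm] /andP[mq qm] /eqP.
rewrite nth_uniq ?enum_uniq -?cardE ?ltn_mod // -(subnKC mp) -(subnKC mq).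
rewrite eqn_modDl !modn_small ?ltn_subLR //.
by move/eqP->.
Qed.

Lemma ageP m v : (m <= age m v < m + #|V|)%N /\ site (age m v) = v.
Proof.
have [i iV iv] := site_window m v.
have vs : v \in [seq site (m + i) | i <- iota 0 #|V|].
  by apply/mapP; exists i; rewrite ?mem_iota.
have lt : (index v [seq site (m + i) | i <- iota 0 #|V|] < #|V|)%N.
  by move: vs; rewrite -index_mem size_map size_iota.
split; first by rewrite leq_addr ltn_add2l.
have := nth_index v0 vs.
by rewrite (nth_map 0%N) ?size_iota // nth_iota.
Qed.

Lemma age_ge m v : (m <= age m v)%N. Proof. by have [/andP[]] := ageP m v. Qed.
Lemma age_lt m v : (age m v < m + #|V|)%N. Proof. by have [/andP[]] := ageP m v. Qed.
Lemma site_age m v : site (age m v) = v. Proof. by have [] := ageP m v. Qed.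

Lemma age_uniq m p : (m <= p < m + #|V|)%N -> age m (site p) = p.
Proof. by move=> mp; apply: (site_inj (ageP m _).1 mp); rewrite site_age. Qed.

Lemma age_site m : age m (site m) = m.
Proof. by apply: age_uniq; rewrite leqnn -[ltnLHS]addn0 ltn_add2l cardV_gt0. Qed.

Lemma ageS m v : v != site m -> age m.+1 v = age m v.
Proof.
move=> vm; rewrite -{1}(site_age m v) age_uniq //.
have := age_ge m v; have := age_lt m v.
have : age m v != m by apply: contraNneq vm => e; rewrite -(site_age m v) e.
lia.
Qed.

End Scan.

(** * Runs of the scan and what they depend on *)

Section Chain.

Variables (C : numFieldType) (V A I : finType) (v0 : V).
Variables (scope : I -> {set V}) (J : I -> finType).
Variables (vio : forall c, pred (J c)) (pat : forall c, J c -> V -> A).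
Variables (D : {set I}) (cstar : I).

Local Notation state := {ffun V -> A}.
Local Notation n := #|V|.
Local Notation site := (site v0).
Local Notation age := (age v0).

Implicit Types (t : state) (rho : nat -> option A).

Definition upd t u x : state := [ffun v => if v == u then x else t v].

(* [None] is a wildcard: the partial state [o] does not exclude that the
   constraint [c] is violated. *)
Definition bad (c : I) (o : V -> option A) :=
  [exists j : J c, vio j &&
    [forall v in scope c, (o v == None) || (o v == Some (pat j v))]].

Definition conceal (U : {set V}) t (v : V) := if v \in U then None else Some (t v).

(** Monotonicity: forgetting values can only create badness. *)
Lemma badS c o o' : (forall v, v \in scope c -> o' v = None \/ o' v = o v) ->
  bad c o -> bad c o'.
Proof.
move=> oo' /existsP[j /andP[vj /forall_inP ov]]; apply/existsP; exists j.
rewrite vj; apply/forall_inP => v vc; have [->|->] := oo' v vc; rewrite ?eqxx //.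
exact: ov.
Qed.

(* With the variables of [U] free, a constraint meeting [W] without being
   contained in it is satisfied whatever its other variables are, so that
   conditional weights depending on [W] only are the same at [t] and [t']. *)
Definition local_agree (U W0 : {set V}) t t' := exists W : {set V},
  [/\ W0 \subset W, {in W, forall v, v \notin U -> t v = t' v} &
    forall c, c \in D -> ~~ [disjoint scope c & W] ->
      scope c \subset W \/ ~~ bad c (conceal U t) /\ ~~ bad c (conceal U t')].

Variables (K : V -> state -> A -> C) (g : state -> C).
Hypothesis K_local : forall u t t',
  local_agree [set u] [set u] t t' -> K u t =1 K u t'.
Hypothesis K_sum1 : forall u t, \sum_x K u t x = 1.
Hypothesis g_local : forall t t',
  local_agree set0 (scope cstar) t t' -> g t = g t'.
Hypothesis g_bad : forall t, ~~ bad cstar (conceal set0 t) -> g t = 0.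
Hypothesis g_le1 : forall t, `|g t| <= 1.

(** Updates act on functions: [run m rho t] is the expectation, under the complex kernels, of [g]
    after the updates of ages [m - 1, ..., 0] applied to [t]. *)
Definition step u (o : option A) (h : state -> C) t : C :=
  if o is Some x then h (upd t u x) else \sum_x K u t x * h (upd t u x).

Fixpoint run m rho : state -> C :=
  if m is m'.+1 then step (site m') (rho m') (run m' rho) else g.

Lemma eq_run m rho rho' : (forall p, (p < m)%N -> rho p = rho' p) ->
  run m rho =1 run m rho'.
Proof.
elim: m => [|m IH] //= e t; rewrite /step e //.
have {}IH : run m rho =1 run m rho' by apply: IH => p /ltnW/e.
by case: (rho' m) => [x|] //; apply: eq_bigr => x _; rewrite IH.
Qed.

Definition compat rho m t := forall v x, rho (age m v) = Some x -> t v = x.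

Lemma compat_upd rho m t x : compat rho m.+1 t ->
  (forall y, rho m = Some y -> y = x) -> compat rho m (upd t (site m) x).
Proof.
move=> ct mx v y; rewrite ffunE; case: eqP => [->|/eqP vm].
  by rewrite age_site => /mx.
by rewrite -ageS // => /ct.
Qed.

Lemma compat_bad rho m t U c : compat rho m t -> bad c (conceal U t) ->
  {in U, forall v, rho (age m v) = None} -> bad c (rho \o age m).
Proof.
move=> ct bt rU; apply: badS bt => v vc /=; rewrite /conceal.
case: ifP => [/rU->|_]; first by left.
by case E: (rho _) => [x|]; [right; rewrite (ct _ _ E)|left].
Qed.

(** All states met by the run stay compatible with the drawn outcomes, so the final one inherits the
    exclusion and [g_bad] applies. *)
Lemma run_bad0 rho m t : ~~ bad cstar (rho \o age 0) -> compat rho m t ->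
  run m rho t = 0.
Proof.
move=> nb; elim: m t => [|m IH] t ct /=.
  by apply: g_bad; apply: contra nb => bt; apply: compat_bad ct bt _ => v; rewrite inE.
rewrite /step; case E: (rho m) => [x|].
  by apply: IH; apply: compat_upd => // y; rewrite E => -[].
rewrite big1 // => x _; rewrite IH ?mulr0 //.
by apply: compat_upd => // y; rewrite E.
Qed.

(* Two runs stay equal on the coordinates whose latest update has its age in
   [P], provided [P] is closed under the dependencies of the kernels. *)
Lemma run_local rho rho' (P : pred nat) N m t t' :
  (forall p, P p -> rho p = rho' p) ->
  (forall q U, (q < N)%N -> q = 0%N /\ U = scope cstar \/ P q /\ U = [set site q] ->
     exists W : {set V}, [/\ U \subset W, {in W, forall v, P (age q v)} &
       forall c, c \in D -> ~~ [disjoint scope c & W] -> scope c \subset W \/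
         ~~ bad c (rho \o age q) /\ ~~ bad c (rho' \o age q)]) ->
  (0 < N)%N -> (m <= N)%N -> compat rho m t -> compat rho' m t' ->
  (forall v, P (age m v) -> t v = t' v) ->
  run m rho t = run m rho' t'.
Proof.
move=> rr' clos N0; elim: m t t' => [|m IH] t t' mN ct ct' kn /=.
  have [|W [UW WP Wc]] := clos 0 (scope cstar) N0; first by left.
  apply: g_local; exists W; split=> // [v /WP /kn //|c cD /(Wc c cD)[|[nb nb']]].
    by left.
  by right; split; [apply: contra nb|apply: contra nb'] => b;
    (apply: compat_bad b _; first eassumption) => w; rewrite inE.
have ctU x : (forall y, rho m = Some y -> y = x) -> compat rho m (upd t (site m) x).
  exact: compat_upd.
have ctU' x : (forall y, rho' m = Some y -> y = x) -> compat rho' m (upd t' (site m) x).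
  exact: compat_upd.
have knU x x' : (P m -> x = x') -> forall v, P (age m v) ->
    upd t (site m) x v = upd t' (site m) x' v.
  move=> xx' v; rewrite !ffunE; case: eqP => [->|/eqP vm]; first by rewrite age_site.
  by rewrite -ageS //; apply: kn.
have {}IH := fun t t' => IH t t' (ltnW mN).
have [Pm|nPm] := boolP (P m).
  rewrite -(rr' _ Pm) /step; case E: (rho m) => [x|].
    apply: IH; first by apply: ctU => y; rewrite E => -[].
      by apply: ctU' => y; rewrite -(rr' _ Pm) E => -[].
    exact: knU.
  have Ks : K (site m) t =1 K (site m) t'.
    have [|W [UW WP Wc]] := clos m [set site m] mN; first by right.
    apply: K_local; exists W; split=> // [v /WP Pv|c cD /(Wc c cD)[|[nb nb']]].
    - by rewrite inE => vm; apply: kn; rewrite ageS.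
    - by left.
    have key r s : compat r m.+1 s -> r m = None -> ~~ bad c (r \o age m) ->
        ~~ bad c (conceal [set site m] s).
      move=> cs r0; apply: contra => b; apply: badS b => w wc /=.
      rewrite /conceal inE; case: eqP => [->|/eqP wm]; first by left; rewrite age_site.
      rewrite -ageS //; case F: (r _) => [x|]; last by left.
      by right; rewrite (cs _ _ F).
    by right; split; [apply: key nb|apply: key nb'; rewrite -?rr'].
  apply: eq_bigr => x _; rewrite Ks; congr (_ * _).
  apply: IH; first by apply: ctU => y; rewrite E.
    by apply: ctU' => y; rewrite -(rr' _ Pm) E.
  exact: knU.
(* The update of age [m] lies outside [P], so its value does not matter. Both sides are compared
   with the run where it is a fixed [x0], and the kernel weights then sum to 1. *)
have [x0 x0E] : exists x0, forall y, rho' m = Some y -> y = x0.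
  case: (rho' m) => [x|]; first by exists x => y [].
  by exists (t (site m)).
have key s r : compat r m.+1 s ->
    (forall x, (forall y, r m = Some y -> y = x) ->
      run m r (upd s (site m) x) = run m rho' (upd t' (site m) x0)) ->
    step (site m) (r m) (run m r) s = run m rho' (upd t' (site m) x0).
  move=> cs re; rewrite /step; case E: (r m) => [x|].
    by apply: re => y; rewrite E => -[].
  under eq_bigr => x _ do rewrite re ?E //.
  by rewrite -big_distrl /= K_sum1 mul1r.
have e1 : step (site m) (rho m) (run m rho) t = run m rho' (upd t' (site m) x0).
  apply: key => // x xE; apply: IH; [exact: ctU|exact: ctU'|].
  by apply: knU; rewrite (negPf nPm).
rewrite e1; symmetry; apply: key => // x xE.
(* [IH] relates runs of [rho] to runs of [rho'] only, so two runs of [rho'] are compared through one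
   of [rho]. *)
transitivity (run m rho (upd t (site m) (odflt (t (site m)) (rho m)))).
  symmetry; apply: IH; [|exact: ctU'|by apply: knU; rewrite (negPf nPm)].
  by apply: ctU => y ->.
apply: IH; [|exact: ctU'|by apply: knU; rewrite (negPf nPm)].
by apply: ctU => y ->.
Qed.

(** The triangle inequality, one update at a time: resolving a [None] costs the absolute sum of the
    kernel. *)
Lemma norm_run_le (b w : nat -> option A -> C) m rho t :
  (forall p o, 0 <= w p o) ->
  (forall p x, `|b p (Some x)| <= w p (Some x)) ->
  (forall p s, `|b p None| * \sum_x `|K (site p) s x| <= w p None) ->
  `|\prod_(p < m) b p (rho p) * run m rho t| <= \prod_(p < m) w p (rho p).
Proof.
move=> w0 bw bKw; elim: m t => [|m IH] t /=; first by rewrite !big_ord0 mul1r.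
rewrite !big_ord_recr /= /step.
have Pi0 : 0 <= \prod_(p < m) w p (rho p) by apply: prodr_ge0.
case E: (rho m) => [x|].
  rewrite mulrAC normrM; apply: ler_pM => //; exact: IH.
rewrite mulr_sumr; apply: (le_trans (ler_norm_sum _ _ _)).
apply: (@le_trans _ _ (\sum_x \prod_(p < m) w p (rho p) *
    (`|b m None| * `|K (site m) t x|))).
  apply: ler_sum => x _.
  rewrite [K _ _ _ * _]mulrC mulrACA normrM [`|b m None * _|]normrM.
  by rewrite ler_wpM2r ?mulr_ge0.
by rewrite -!mulr_sumr ler_wpM2l.
Qed.

(** Start the window at the most recent update of a variable of [c]: only updates of other variables
    are skipped. *)
Lemma canonical_window c q : scope c != set0 ->
  exists s, [/\ (q <= s < q + n)%N, site s \in scope c &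
    {in scope c, forall v, age s v = age q v}].
Proof.
case/set0Pn=> v1 v1c.
have [v vc vmin] := arg_minnP (age q) v1c.
exists (age q v); split; first by rewrite age_ge age_lt.
  by rewrite site_age.
move=> w wc; rewrite -{1}(site_age v0 q w) age_uniq //.
have /= -> := vmin w wc.
by rewrite (leq_trans (age_lt _ _ _)) // leq_add2r age_ge.
Qed.

(** * Instances of constraints and their adjacency *)

Variables (N k Delta m0 : nat).
Hypothesis cstarD : cstar \in D.
Hypothesis k_gt0 : (0 < k)%N.
Hypothesis scope_card : forall c, c \in D -> #|scope c| = k.
Hypothesis degree : forall v, (#|[set c in D | v \in scope c]| <= Delta)%N.
Hypothesis NE : N = (n * (2 * m0 + 6))%N.

Definition instance : finType := (I * 'I_N)%type.
Implicit Types (e : instance) (r : {ffun 'I_N -> option A}) (T : {set instance}).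

(* [(c, s)] is the constraint [c] seen through the window starting at [s].  Only
   windows starting at an update of a variable of [c] are kept: other windows
   see the same updates of these variables, and counting them would spoil the
   degree bound of [card_adj]. *)
Definition valid e :=
  [&& e.1 \in D, site e.2 \in scope e.1 & (e.2 + n <= N)%N].

Definition points e : {set 'I_N} :=
  [set p : 'I_N | [exists v in scope e.1, p == age e.2 v :> nat]].

Definition adj : rel instance :=
  [rel e e' | [&& valid e, valid e' & ~~ [disjoint points e & points e']]].

(** Ages from [N] on belong to the initial state and count as unknown, so that every state is
    compatible at time [N]. *)
Definition at_age r (p : nat) : option A := if insub p is Some i then r i else None.

Lemma at_ageE r (i : 'I_N) : at_age r i = r i.
Proof. by rewrite /at_age valK. Qed.

Lemma at_age_ge r p : (N <= p)%N -> at_age r p = None.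
Proof. by move=> Np; rewrite /at_age insubF // ltnNge Np. Qed.

Lemma pointsP e (p : 'I_N) :
  reflect (exists2 v, v \in scope e.1 & p = age e.2 v :> nat) (p \in points e).
Proof. by rewrite inE; apply: (iffP exists_inP) => -[v vc /eqP]; exists v => //; apply/eqP. Qed.

Lemma valid_age e v : valid e -> (age e.2 v < N)%N.
Proof. by move=> /and3P[_ _]; apply: leq_trans; rewrite age_lt. Qed.

Lemma points_self e : valid e -> e.2 \in points e.
Proof.
by move=> /and3P[_ ec _]; apply/pointsP; exists (site e.2); rewrite ?age_site.
Qed.

Lemma points_window e (p : 'I_N) : p \in points e -> (e.2 <= p < e.2 + n)%N.
Proof. by move=> /pointsP[v _ ->]; rewrite age_ge age_lt. Qed.

Lemma adj_sym : symmetric adj.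
Proof. by move=> e e'; rewrite /adj /= disjoint_sym andbCA. Qed.

Lemma adj_refl e : valid e -> adj e e.
Proof.
move=> ve; rewrite /adj /= ve; apply/pred0Pn; exists e.2.
by rewrite /= points_self.
Qed.

Lemma adjP e e' : reflect ([/\ valid e, valid e' & exists2 p, p \in points e & p \in points e'])
  (adj e e').
Proof.
apply: (iffP and3P) => -[ve ve'].
  by move=> /pred0Pn[p /andP[/= pe pe']]; split=> //; exists p.
by move=> [p pe pe']; split=> //; apply/pred0Pn; exists p; rewrite /= pe.
Qed.

Lemma card_points e : e.1 \in D -> (#|points e| <= k)%N.
Proof.
move=> eD; rewrite -(scope_card eD).
have -> : #|points e| = #|[set site p | p : 'I_N in points e]|.
  rewrite card_in_imset // => p q /points_window pw /points_window qw /(site_inj pw qw).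
  exact: val_inj.
apply: subset_leq_card; apply/subsetP => v /imsetP[p /pointsP[w wc ->] ->].
by rewrite site_age.
Qed.

(** A neighbour is determined by a shared point ([k] choices), a constraint on the variable updated
    there ([Delta] choices), and the start of its window, an update of one of its variables less
    than [n] ages before the point ([k] choices). *)
Lemma card_adj e : (#|[set e' | adj e e']| <= Delta * k ^ 2)%N.
Proof.
have [ve|nve] := boolP (valid e); last first.
  by rewrite eq_card0 // => e'; rewrite !inE /adj /= (negPf nve).
pose S (c : I) (p : 'I_N) : {set 'I_N} :=
  [set s : 'I_N | (s <= p < s + n)%N && (site s \in scope c)].
have cardS c p : c \in D -> (#|S c p| <= k)%N.
  move=> cD; rewrite -(scope_card cD).
  have -> : #|S c p| = #|[set site s | s : 'I_N in S c p]|.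
    rewrite card_in_imset // => s s'; rewrite !inE => /andP[sw _] /andP[sw' _].
    move=> e1; apply: val_inj; move: e1; apply: (site_inj (m := (p.+1 - n)%N)); lia.
  by apply: subset_leq_card; apply/subsetP => v /imsetP[s + ->]; rewrite inE => /andP[].
have sub : [set e' | adj e e'] \subset
    \bigcup_(p in points e) \bigcup_(c in [set c in D | site p \in scope c])
      [set (c, s) | s in S c p].
  apply/subsetP => -[c s]; rewrite inE => /adjP[_ /= vs [p pe ps]].
  apply/bigcupP; exists p => //; have /and3P[/= cD sc _] := vs.
  apply/bigcupP; exists c.
    by rewrite inE cD; move: ps => /pointsP[v vc ->]; rewrite site_age.
  by apply/imsetP; exists s => //; rewrite inE sc andbT; apply: points_window ps.
apply: (leq_trans (subset_leq_card sub)); apply: (leq_trans (leq_card_bigcup _ _)).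
apply: (@leq_trans (\sum_(p in points e) Delta * k)).
  apply: leq_sum => p _; apply: (leq_trans (leq_card_bigcup _ _)).
  apply: (@leq_trans (\sum_(c in [set c in D | site p \in scope c]) k)).
    apply: leq_sum => c; rewrite inE => /andP[cD _].
    by rewrite card_imset ?cardS // => s s' [].
  by rewrite sum_nat_const leq_mul2r degree orbT.
rewrite sum_nat_const mulnC expnS expn1 mulnA leq_mul2l.
by rewrite card_points ?orbT //; case/and3P: ve.
Qed.

Lemma card_adj2 e : (#|[set e' | adj2 adj e e']| <= (Delta * k ^ 2) ^ 2)%N.
Proof.
have sub : [set e' | adj2 adj e e'] \subset
    \bigcup_(z in [set z | adj e z]) [set e' | adj z e'].
  apply/subsetP => e'; rewrite inE => /existsP[z /andP[ez ze']].
  by apply/bigcupP; exists z; rewrite inE.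
apply: (leq_trans (subset_leq_card sub)); apply: (leq_trans (leq_card_bigcup _ _)).
apply: (@leq_trans (\sum_(z in [set z | adj e z]) Delta * k ^ 2)).
  by apply: leq_sum => z _; apply: card_adj.
by rewrite sum_nat_const expnS expn1 leq_mul2r card_adj orbT.
Qed.

Definition bad_set r : {set instance} :=
  [set e | valid e && bad e.1 (at_age r \o age e.2)].

Lemma bad_agree r r' e : valid e -> {in points e, r =1 r'} ->
  bad e.1 (at_age r \o age e.2) -> bad e.1 (at_age r' \o age e.2).
Proof.
move=> ve rr'; apply: badS => v vc /=; right.
rewrite -[age e.2 v]/(val (Ordinal (valid_age v ve))) !at_ageE rr' //.
by apply/pointsP; exists v.
Qed.

(** * The bad cluster of the final instance of [cstar] and its 2-tree *)

Variable e0 : instance.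
Hypothesis e0_valid : valid e0.
Hypothesis e0_star : e0.1 = cstar.
Hypothesis e0_lt : (e0.2 < n)%N.
Hypothesis e0_age : {in scope cstar, forall v, age e0.2 v = age 0 v}.

Definition bad_cluster r := cluster e0 adj (bad_set r).

Lemma bad_cluster_valid r e : e0 \in bad_set r -> e \in bad_cluster r -> valid e.
Proof. by move=> /cluster_sub/subsetP sub /sub; rewrite inE => /andP[]. Qed.

(** Exploring the cluster only queries the neighbours of instances already found. *)
Lemma bad_cluster_agree r r' : e0 \in bad_set r ->
  (forall e e', e \in bad_cluster r -> adj e e' -> {in points e', r =1 r'}) ->
  bad_cluster r' = bad_cluster r /\ e0 \in bad_set r'.
Proof.
move=> e0r rr'.
have bb' e e' : e \in bad_cluster r -> adj e e' -> (e' \in bad_set r) = (e' \in bad_set r').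
  move=> er ee'; have /adjP[_ ve' _] := ee'.
  rewrite !inE ve' /=; apply/idP/idP; apply: bad_agree => //.
    exact: rr' er ee'.
  by move=> p pe'; rewrite (rr' _ _ er ee').
have e0r' : e0 \in bad_set r'.
  by rewrite -(bb' e0) ?adj_refl ?cluster_root.
split=> //; apply/eqP; rewrite eqEsubset; apply/andP; split; apply/subsetP.
  apply: cluster_ind => [|x y xr xy yr']; first exact: cluster_root.
  by apply: (cluster_step xr xy); rewrite (bb' _ _ xr xy).
move=> y yr; suff /andP[] : (y \in bad_cluster r') && (y \in bad_cluster r) by [].
move: y yr; apply: cluster_ind => [|x y /andP[xr' xr] xy yr]; first by rewrite !cluster_root.
rewrite (cluster_step xr' xy) -?(bb' _ _ xr xy) //=.
exact: cluster_step xr xy yr.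
Qed.

(** The tree is picked from the cluster alone, so equal clusters give equal trees. *)
Definition tree_of (B : {set instance}) : {set instance} :=
  odflt set0 [pick T : {set instance} | [&& T \subset B, two_tree e0 adj T &
    [forall y in B, exists t in T, adj t y]]].

Lemma tree_ofP r (T := tree_of (bad_cluster r)) : e0 \in bad_set r ->
  [/\ T \subset bad_cluster r, two_tree e0 adj T &
      forall y, y \in bad_cluster r -> exists2 t, t \in T & adj t y].
Proof.
move=> e0r; rewrite /T /tree_of; case: pickP => [T' /and3P[TB TT /forall_inP Tdom]|none].
  by split=> // y /Tdom/exists_inP.
have [e er|T' [TB TT Tdom]] := two_tree_exists adj_sym _ (clusterK adj e0r).
  by apply: adj_refl; apply: bad_cluster_valid er.
have := none T'; rewrite TB TT /= => /negP[].
by apply/forall_inP => y /Tdom ?; apply/exists_inP.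
Qed.

(** The cluster is within one step of the tree that dominates it, so two steps also cover the
    neighbours that bound the cluster. *)
Definition reach T : {set 'I_N} :=
  \bigcup_(e in T) \bigcup_(e' in [set e' | adj2 adj e e']) points e'.

(* The oldest ages are revealed when the tree is so large that its cluster
   might depend on the initial state. *)
Definition revealed T : {set 'I_N} :=
  [set p : 'I_N | (p \in reach T) || (m0 <= #|T|)%N && (N - 3 * n <= p)%N].

Lemma n_gt0 : (0 < n)%N. Proof. exact: (cardV_gt0 v0). Qed.

Lemma N_split : N = (2 * n * m0 + 6 * n)%N.
Proof. by rewrite NE mulnDr mulnA [(n * 2)%N]mulnC [(n * 6)%N]mulnC. Qed.

Lemma N_gt0 : (0 < N)%N. Proof. by have := n_gt0; have := N_split; lia. Qed.

(** Each step of the tree moves the start of the window by less than [2 * n], and domination adds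
    less than [n]. The choice of [N] leaves [3 * n] ages beyond this. *)
Lemma bad_cluster_range r e : e0 \in bad_set r -> e \in bad_cluster r ->
  (#|tree_of (bad_cluster r)| < m0)%N -> (e.2 + 3 * n <= N)%N.
Proof.
move=> e0r er lt.
have [TB /andP[/eqP TE _] Tdom] := tree_ofP e0r.
have adj_range x y : adj x y -> (y.2 < x.2 + n)%N.
  by move=> /adjP[_ _ [p /points_window px /points_window py]]; lia.
have [t tT ty] := Tdom e er.
have le : (t.2 <= e0.2 + 2 * n * #|tree_of (bad_cluster r)|)%N.
  apply: (cluster_range (h := fun e : instance => e.2 : nat) _ TE tT).
  move=> x y /existsP[z /andP[/adj_range xz /adj_range zy]] /=.
  by rewrite mul2n -addnn addnA (leq_trans (ltnW zy)) // leq_add2r ltnW.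
have := adj_range _ _ ty.
have : (2 * n * #|tree_of (bad_cluster r)| <= 2 * n * m0)%N.
  by rewrite leq_mul2l ltnW ?orbT.
have := e0_lt; have := N_split; move: le.
move: (nat_of_ord e.2) (nat_of_ord t.2) (nat_of_ord e0.2) #|tree_of _| n.
by move=> a b c d w; lia.
Qed.

Lemma sub_reach r e e' : e0 \in bad_set r -> e \in bad_cluster r -> adj e e' ->
  points e' \subset revealed (tree_of (bad_cluster r)).
Proof.
move=> e0r er ee'; have [_ _ Tdom] := tree_ofP e0r; have [t tT te] := Tdom e er.
apply/subsetP => p pe'; rewrite inE; apply/orP; left.
apply/bigcupP; exists t => //; apply/bigcupP; exists e' => //.
by rewrite inE; apply/existsP; exists e; rewrite te.
Qed.

(** [run_local] is applied to the ages seen by the cluster, together with the oldest ages when the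
    tree is large. A constraint that sees an age of the cluster is itself a member, or a neighbour
    that is not bad. *)
Lemma run_revealed r r' t t' (T := tree_of (bad_cluster r)) : e0 \in bad_set r ->
  {in revealed T, r =1 r'} -> t = t' \/ (#|T| < m0)%N ->
  [/\ e0 \in bad_set r', tree_of (bad_cluster r') = T &
      run N (at_age r) t = run N (at_age r') t'].
Proof.
move=> e0r rr' tt'.
have agree e e' : e \in bad_cluster r -> adj e e' -> {in points e', r =1 r'}.
  by move=> er ee' p pe'; apply: rr'; apply: subsetP (sub_reach e0r er ee') _ pe'.
have [Br' e0r'] := bad_cluster_agree e0r agree.
split; [exact: e0r'|by rewrite Br'|].
pose inB (p : nat) := [exists e in bad_cluster r, exists i : 'I_N,
  (i \in points e) && (i == p :> nat)].
have inBP (p : nat) : reflect (exists e (i : 'I_N),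
    [/\ e \in bad_cluster r, i \in points e & p = i :> nat])
    (inB p).
  apply: (iffP exists_inP) => [[e er /existsP[i /andP[ie /eqP ip]]]|[e [i [er ie ->]]]].
    by exists e, i; split.
  by exists e => //; apply/existsP; exists i; rewrite ie eqxx.
pose deep := (m0 <= #|T|)%N.
pose P p := inB p || deep && (N - 3 * n <= p)%N.
have e0c : e0 \in bad_cluster r by exact: cluster_root.
(* The [2 * n] ages left after [q] make a canonical window from [q] a valid instance. *)
have cl_range q : ~~ (deep && (N - 3 * n <= q)%N) -> inB q -> (q + 2 * n <= N)%N.
  rewrite negb_and -!ltnNge => /orP[lt|lt _]; last by have := n_gt0; lia.
  move=> /inBP[e [i [er /points_window ie ->]]].
  by have := bad_cluster_range e0r er lt; lia.
have compat_N (s : {ffun 'I_N -> option A}) (x : state) : compat (at_age s) N x.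
  by move=> v y; rewrite at_age_ge ?age_ge.
apply: (@run_local _ _ P N); [| |exact: N_gt0|exact: leqnn|exact: compat_N|exact: compat_N|].
- move=> p /orP[/inBP[e [i [er ie ->]]]|/andP[dp Np]].
    rewrite !at_ageE; apply: (agree e e er _ i ie).
    by apply: adj_refl; apply: bad_cluster_valid er.
  have [pN|pN] := ltnP p N; last by rewrite !at_age_ge.
  by rewrite -[p]/(val (Ordinal pN)) !at_ageE; apply: rr'; rewrite inE /= -/deep dp Np orbT.
- move=> q U qN qU.
  (* Among the oldest ages of a deep run everything is revealed, and all of [V] serves as the
     witness. *)
  have [/andP[dp Nq]|ndq] := boolP (deep && (N - 3 * n <= q)%N).
    exists setT; split=> [|v _|c _ _]; [exact: subsetT| |by left; exact: subsetT].
    by rewrite /P dp /= (leq_trans Nq (age_ge _ _ _)) orbT.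
  exists [set v | inB (age q v)]; split.
  + case: qU => -[qE ->].
      rewrite qE; apply/subsetP => v vc; rewrite inE; apply/inBP.
      exists e0, (Ordinal (valid_age v e0_valid)); split=> //=; last by rewrite e0_age.
      by apply/pointsP; exists v; rewrite ?e0_star.
    rewrite sub1set inE age_site.
    by move: qE; rewrite /P (negPf ndq) orbF.
  + by move=> v; rewrite inE /P => ->.
  move=> c cD /pred0Pn[v /andP[/= vc]]; rewrite inE => vB.
  have q2 : (q + 2 * n <= N)%N.
    case: qU => -[qE _]; last by apply: (cl_range _ ndq); move: qE; rewrite /P (negPf ndq) orbF.
    by rewrite qE add0n N_split (leq_trans _ (leq_addl _ _)) // leq_mul2r orbT.
  have [|s [sw sc sage]] := @canonical_window c q; first by apply/set0Pn; exists v.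
  have sN : (s < N)%N.
    case/andP: sw => _ sw; apply: leq_trans (leq_trans sw _) q2.
    by rewrite leq_add2l leq_pmull.
  pose e' : instance := (c, Ordinal sN).
  have ve' : valid e'.
    rewrite /valid cD sc /= (leq_trans _ q2) // mul2n -addnn addnA leq_add2r ltnW //.
    by case/andP: sw.
  have [e [i [er ie iE]]] := inBP _ vB.
  have ee' : adj e e'.
    apply/adjP; split=> //; first exact: bad_cluster_valid er.
    by exists i => //; apply/pointsP; exists v => //=; rewrite sage.
  have badE s' : bad c (at_age s' \o age q) = bad e'.1 (at_age s' \o age e'.2).
    by apply/idP/idP; apply: badS => w wc; right; rewrite /= sage.
  (* If the neighbour [e'] is bad it joins the cluster, and its whole scope is known; otherwise it
     is not bad for [r'] either, which agrees with [r] there. *)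
  have [b|nb] := boolP (bad c (at_age r \o age q)).
    left; apply/subsetP => w wc; rewrite inE; apply/inBP.
    exists e', (Ordinal (valid_age w ve')); split=> /=; last by rewrite sage.
      by apply: cluster_step er ee' _; rewrite inE ve' -badE.
    by apply/pointsP; exists w.
  right; split=> //; apply: contra nb; rewrite !badE; apply: bad_agree => // p pe'.
  by rewrite (agree _ _ er ee').
(* For a small tree [P] holds only below [N], so the initial states are never read. *)
move=> v; case: tt' => [->//|lt].
rewrite /P /deep leqNgt lt /= orbF => /inBP[e [i [er ie iE]]].
by have := ltn_ord i; rewrite -iE ltnNge age_ge.
Qed.

(** * The contribution of a single tree *)

Variables (b : V -> option A -> C) (psi : state -> C) (Rb : V -> C) (M Nn : C).
Hypothesis b_sum1 : forall u, \sum_o b u o = 1.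
Hypothesis psi_sum1 : \sum_t psi t = 1.
Hypothesis stationary : forall u h,
  \sum_t psi t * h t = \sum_t psi t * \sum_o b u o * step u o h t.
Hypothesis K_bound : forall u t, `|b u None| * \sum_x `|K u t x| <= Rb u.

Definition cost u (o : option A) : C := if o is Some x then `|b u (Some x)| else Rb u.

Hypothesis M_bound : forall u, \sum_o cost u o <= M.
Hypothesis N_bound : forall c, c \in D ->
  \sum_(j : J c | vio j) \prod_(v in scope c) (cost v (Some (pat j v)) + Rb v) <= Nn.

(** The argument supplies a state at which [K_bound] can be evaluated. *)
Lemma Rb_ge0 u : state -> 0 <= Rb u.
Proof.
move=> t; apply: le_trans (K_bound u t).
by rewrite mulr_ge0 // sumr_ge0.
Qed.

Lemma cost_ge0 u o : state -> 0 <= cost u o.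
Proof. by case: o => [x|] t //=; apply: Rb_ge0. Qed.

(** The weights [b] sum to 1, and [|b None| <= Rb] because the kernel sums to 1. This allows
    exponents of [M] to be enlarged. *)
Lemma M_ge1 : state -> 1 <= M.
Proof.
move=> t; apply: le_trans (M_bound v0); rewrite -normr1 -(b_sum1 v0).
apply: (le_trans (ler_norm_sum _ _ _)); apply: ler_sum => -[x|] _ //=.
apply: le_trans (K_bound v0 t); rewrite -[leLHS]mulr1 ler_wpM2l //.
by rewrite -normr1 -(K_sum1 v0 t) ler_norm_sum.
Qed.

Lemma Nn_ge0 : state -> 0 <= Nn.
Proof.
move=> t; apply: le_trans (N_bound cstarD); apply: sumr_ge0 => j _.
by apply: prodr_ge0 => v _; rewrite addr_ge0 ?(cost_ge0 _ _ t) ?(Rb_ge0 _ t).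
Qed.

(** Each step inserts one older update: stationarity averages over its outcome, and
    [sum_prod_average] reads that outcome from a coordinate of [r] which the shorter run does not
    use. *)
Lemma sum_run m : (m <= N)%N -> \sum_t psi t * g t =
  \sum_(r : {ffun 'I_N -> option A})
    (\prod_(p < N) b (site p) (r p)) * \sum_t psi t * run m (at_age r) t.
Proof.
elim: m => [|m IH] mN.
  by rewrite /= -mulr_suml (sum_prod1 (b := fun (p : 'I_N) o => b (site p) o)) ?mul1r.
rewrite (IH (ltnW mN)).
apply: (sum_prod_average (b := fun (p : 'I_N) o => b (site p) o) (x0 := Ordinal mN)
  (H := fun o r => \sum_t psi t * step (site m) o (run m (at_age r)) t))
  => [p|r|r q]; first exact: b_sum1.
  rewrite (stationary (site m)) /=; under eq_bigr do rewrite mulr_sumr.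
  rewrite exchange_big /=; apply: eq_bigr => o _; rewrite mulr_sumr.
  by apply: eq_bigr => t _; rewrite mulrCA.
apply: eq_bigr => t _; congr (_ * _).
have -> : run m.+1 (at_age (splice (predC1 (Ordinal mN)) r q)) t =
    step (site m) (at_age (splice (predC1 (Ordinal mN)) r q) (Ordinal mN))
      (run m (at_age (splice (predC1 (Ordinal mN)) r q))) t by [].
rewrite at_ageE ffunE /= inE eqxx /=.
have e : run m (at_age (splice (predC1 (Ordinal mN)) r q)) =1 run m (at_age r).
  apply: eq_run => p pm; rewrite -[p]/(val (Ordinal (ltn_trans pm mN))) !at_ageE ffunE.
  by rewrite !inE -val_eqE /= ltn_eqF.
rewrite /step; case: (q _) => [x|]; first by rewrite e.
by apply: eq_bigr => x _; rewrite e.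
Qed.

Definition tree_sum T t : C := \sum_(r : {ffun 'I_N -> option A})
  (\prod_(p < N) b (site p) (r p)) *
  (((e0 \in bad_set r) && (tree_of (bad_cluster r) == T))%:R * run N (at_age r) t).

Lemma tree_sum_const T t t' : (#|T| < m0)%N -> tree_sum T t = tree_sum T t'.
Proof.
move=> lt; apply: eq_bigr => r _; congr (_ * _).
case: (boolP (_ && _)) => [/andP[e0r /eqP TE]|]; last by rewrite !mul0r.
have [| |_ _ ->] := @run_revealed r r t t' e0r _ _; rewrite ?TE //.
by right.
Qed.

(** Updates that are not revealed affect neither the indicator nor the run. In [tree_sum_le] they
    become point masses, for which absolute values cost nothing. *)
Lemma tree_sum_resample T t (b' : 'I_N -> option A -> C) :
  (forall p, \sum_o b' p o = 1) -> (forall p, p \in revealed T -> b (site p) =1 b' p) ->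
  tree_sum T t = \sum_(r : {ffun 'I_N -> option A}) (\prod_(p < N) b' p (r p)) *
  (((e0 \in bad_set r) && (tree_of (bad_cluster r) == T))%:R * run N (at_age r) t).
Proof.
move=> b'1 bb'.
apply: (sum_prod_resample (b := fun (p : 'I_N) o => b (site p) o) (S := mem (revealed T)))
  => [p|p|p|r q rq]; [exact: b_sum1|exact: b'1|exact: bb'|].
have key (r1 r2 : {ffun 'I_N -> option A}) : {in revealed T, r1 =1 r2} ->
    (e0 \in bad_set r1) && (tree_of (bad_cluster r1) == T) ->
    (e0 \in bad_set r2) && (tree_of (bad_cluster r2) == T) /\
    run N (at_age r1) t = run N (at_age r2) t.
  move=> r12 /andP[e1 /eqP T1].
  have [||-> -> ->] := @run_revealed r1 r2 t t e1; rewrite ?T1 ?eqxx //.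
  by left.
case: (boolP (_ && _)) => [/(key _ _ rq)[-> ->] //|nr].
case: (boolP ((e0 \in bad_set q) && _)) => [/(key q r)[p pE|Tr _]|]; rewrite ?mul0r //.
  by rewrite rq.
by rewrite Tr in nr.
Qed.

(** All members of [T] are bad and, by independence, have disjoint points: each yields a factor
    [Nn]. Every other revealed update costs at most [M]. *)
Lemma tree_sum_le T t : `|tree_sum T t| <=
  (two_tree e0 adj T)%:R * (Nn ^+ #|T| * M ^+ #|revealed T|).
Proof.
have a0 := t v0; have M1 := M_ge1 t; have N0 := Nn_ge0 t.
pose b' (p : nat) o : C :=
  if p \in [seq val i | i in revealed T] then b (site p) o else (o == Some a0)%:R.
pose w (p : nat) o : C :=
  if p \in [seq val i | i in revealed T] then cost (site p) o else (o == Some a0)%:R.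
have inR (p : 'I_N) : (val p \in [seq val i | i in revealed T]) = (p \in revealed T).
  by rewrite mem_image //; apply: val_inj.
have sum_delta : \sum_(o : option A) (o == Some a0)%:R = 1 :> C.
  by rewrite (bigD1 (Some a0)) //= eqxx big1 ?addr0 // => o /negPf->.
have w0 p o : 0 <= w p o by rewrite /w; case: ifP => // _; rewrite (cost_ge0 _ _ t).
rewrite (@tree_sum_resample T t (fun p : 'I_N => b' p)); last 2 first.
- by move=> p; rewrite /b'; case: (_ \in _).
- by move=> p pR o; rewrite /b' inR pR.
have [|nT] := boolP [exists r : {ffun 'I_N -> option A},
    (e0 \in bad_set r) && (tree_of (bad_cluster r) == T)]; last first.
  rewrite big1 ?normr0 => [|r _]; last first.
    by move/existsPn/(_ r)/negPf: nT => ->; rewrite mul0r mulr0.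
  by rewrite !mulr_ge0 ?exprn_ge0 // (le_trans ler01).
move=> /existsP[r0 /andP[e0r0 /eqP TE]].
have [TB TT _] := tree_ofP e0r0; rewrite TE in TB TT; rewrite TT mul1r.
have Tvalid e : e \in T -> valid e.
  by move=> /(subsetP TB); apply: bad_cluster_valid.
apply: (@le_trans _ _ (\sum_(r : {ffun 'I_N -> option A}) (\prod_(p : 'I_N) w p (r p)) *
    (all (fun e => valid e && bad e.1 (at_age r \o age e.2)) (enum T))%:R)).
  apply: (le_trans (ler_norm_sum _ _ _)); apply: ler_sum => r _.
  case: (boolP (_ && _)) => [/andP[e0r /eqP Tr]|_]; last first.
    by rewrite mul0r mulr0 normr0 mulr_ge0 // prodr_ge0.
  have -> : all (fun e => valid e && bad e.1 (at_age r \o age e.2)) (enum T).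
    apply/allP => e; rewrite mem_enum -Tr => eT.
    have [/subsetP TBr _ _] := tree_ofP e0r.
    have /subsetP sub := cluster_sub adj e0r.
    by have := sub _ (TBr _ eT); rewrite inE.
  rewrite mul1r mulr1.
  have e1 : \prod_(p < N) b' p (r p) = \prod_(p < N) b' p (at_age r p).
    by apply: eq_bigr => p _; rewrite at_ageE.
  have e2 : \prod_(p : 'I_N) w p (r p) = \prod_(p < N) w p (at_age r p).
    by apply: eq_bigr => p _; rewrite at_ageE.
  rewrite e1 e2; apply: norm_run_le => //.
  - by move=> p x; rewrite /b' /w; case: ifP => //= _; rewrite normr_nat.
  - move=> p s; rewrite /b' /w; case: ifP => [_|_ /=]; first exact: K_bound.
    by rewrite normr0 mul0r.
have NT : forall e, e \in enum T ->
    \sum_(j : J e.1 | vio j) \prod_(x in points e) \sum_o w x o *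
      ((o == None) || (o == Some (pat j (site x))))%:R <= Nn.
  move=> e; rewrite mem_enum => eT; have ve := Tvalid e eT.
  have /and3P[eD _ _] := ve.
  apply: le_trans (N_bound eD); apply: ler_sum => j _.
  have inj : {in points e &, injective (fun p : 'I_N => site p)}.
    by move=> p q /points_window pw /points_window qw /(site_inj pw qw)/val_inj.
  have sE : [set site p | p : 'I_N in points e] = scope e.1.
    apply/setP => v; apply/imsetP/idP => [[p /pointsP[v' v'c ->] ->]|vc].
      by rewrite site_age.
    exists (Ordinal (valid_age v ve)); last by rewrite /= site_age.
    by apply/pointsP; exists v.
  rewrite -sE big_imset //= le_eqVlt; apply/orP; left; apply/eqP.
  apply: eq_bigr => p pe.
  have pR : p \in revealed T.
    rewrite inE; apply/orP; left; apply/bigcupP; exists e => //.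
    apply/bigcupP; exists e => //; rewrite inE; apply/existsP; exists e.
    by rewrite adj_refl.
  rewrite /w inR pR (bigD1 None) //= mulr1 (bigD1 (Some (pat j (site p)))) //=.
  rewrite eqxx mulr1 [X in _ + (_ + X)]big1 ?addr0; first exact: addrC.
  by move=> [x|] //= /negPf->; rewrite mulr0.
apply: le_trans (sum_prod_disjoint (D := points)
  (P := fun e (r : {ffun 'I_N -> option A}) => valid e && bad e.1 (at_age r \o age e.2))
  (w := fun (p : 'I_N) o => w p o) _ N0 (enum_uniq T) _ NT _) _ => //.
- move=> e r /andP[ve /existsP[j /andP[vj /forall_inP jb]]]; exists j => // p /pointsP[v vc pE].
  by have := jb v vc; rewrite /= -pE at_ageE pE site_age.
- move=> e e'; rewrite !mem_enum => eT e'T ee'.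
  have /andP[_ /forall_inP/(_ e eT)/forall_inP/(_ e' e'T)] := TT.
  by rewrite ee' /adj /= !Tvalid //= negbK.
rewrite -cardE ler_wpM2l ?exprn_ge0 //.
rewrite -prodr_const [leRHS]big_mkcond [leLHS]big_mkcond /=; apply: ler_prod => p _.
apply/andP; split; first by case: ifP => // _; rewrite sumr_ge0.
case: ifP => _; last by case: ifP.
rewrite (eq_bigr (w p)) // /w inR; case: ifP => // _.
by rewrite sum_delta.
Qed.

Lemma card_revealed T : (#|revealed T| <=
  (Delta * k ^ 2) ^ 2 * k * #|T| + (if (m0 <= #|T|)%N then 3 * n else 0))%N.
Proof.
have sub : revealed T \subset reach T :|:
    [set p : 'I_N | (m0 <= #|T|)%N && (N - 3 * n <= p)%N].
  by apply/subsetP => p; rewrite !inE.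
apply: (leq_trans (subset_leq_card sub)); apply: (leq_trans (leq_card_setU _ _)).
apply: leq_add.
  apply: (leq_trans (leq_card_bigcup _ _)).
  apply: (@leq_trans (\sum_(e in T) (Delta * k ^ 2) ^ 2 * k)); last first.
    by rewrite sum_nat_const mulnC.
  apply: leq_sum => e _; apply: (leq_trans (leq_card_bigcup _ _)).
  apply: (@leq_trans (\sum_(e' in [set e' | adj2 adj e e']) k)).
    apply: leq_sum => e'; rewrite inE => /existsP[z /andP[_ /adjP[_ ve' _]]].
    by apply: card_points; case/and3P: ve'.
  by rewrite sum_nat_const leq_mul2r card_adj2 orbT.
case: (leqP m0 #|T|) => _; last by rewrite eq_card0 // => p; rewrite inE.
rewrite cardE -(size_map val) -[leqRHS](size_iota (N - 3 * n)).
apply: uniq_leq_size; first by rewrite (map_inj_uniq val_inj) enum_uniq.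
move=> i /mapP[p]; rewrite mem_enum inE /= mem_iota => Np ->; rewrite Np /=.
by have := ltn_ord p; have := N_split; lia.
Qed.

Lemma Bernoulli_ineq (p : C) d : 0 <= p <= 1 -> 1 - d%:R * p <= (1 - p) ^+ d.
Proof.
move=> /andP[p0 p1]; have q0 : 0 <= 1 - p by rewrite subr_ge0.
elim: d => [|d IH]; first by rewrite mul0r subr0 expr0.
rewrite exprS mulrBl mul1r -natr1 mulrDl mul1r opprD addrA lerB //.
by rewrite -[leRHS]mulr1 ler_wpM2l // exprn_ile1 // gerBl.
Qed.

(** * Summation over all trees *)

Let d := ((Delta * k ^ 2) ^ 2)%N.
Variable expo : nat.
Let y : C := Nn * M ^+ expo.

Hypothesis expo_ge : (d * k <= expo)%N.
Hypothesis y_small : 16 * d%:R * y <= 1.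

Lemma d_gt0 : (0 < d)%N.
Proof.
have /card_gt0P[v vc] : (0 < #|scope cstar|)%N by rewrite scope_card.
rewrite /d expn_gt0 muln_gt0 expn_gt0 k_gt0 /= andbT orbF.
apply: leq_trans (degree v); apply/card_gt0P; exists cstar.
by rewrite inE cstarD.
Qed.

(** With percolation parameter [1 / (2 d)], Bernoulli's inequality gives
    [(1 - 1 / (2 d)) ^ d >= 1/2], so the right side is at least [1 / (4 d)]. *)
Lemma tree_weight_le : 4 * y <= (2 * d%:R)^-1 * (1 - (2 * d%:R)^-1) ^+ d.
Proof.
have d0 : 0 < d%:R :> C by rewrite ltr0n d_gt0.
have dd0 : 0 < 2 * d%:R :> C by rewrite mulr_gt0.
apply: (@le_trans _ _ ((2 * d%:R)^-1 * 2^-1)).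
  rewrite -invfM -[leRHS]mul1r ler_pdivlMr ?mulr_gt0 //.
  by apply: le_trans y_small; rewrite le_eqVlt; apply/orP; left; apply/eqP; ring.
rewrite ler_wpM2l ?invr_ge0 ?(ltW dd0) //.
apply: (le_trans _ (Bernoulli_ineq d _)); last first.
  rewrite invr_ge0 ltW //= invf_le1 // (le_trans (_ : 1 <= 2)) ?ler1n //.
  by rewrite ler_peMr ?ler1n ?d_gt0.
rewrite invfM mulrCA mulfV ?gt_eqF // mulr1.
by rewrite le_eqVlt; apply/orP; left; apply/eqP; field.
Qed.

Lemma run_split r t : run N (at_age r) t =
  \sum_T ((e0 \in bad_set r) && (tree_of (bad_cluster r) == T))%:R *
         run N (at_age r) t.
Proof.
case: (boolP (e0 \in bad_set r)) => [_|nb] /=.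
  rewrite (bigD1 (tree_of (bad_cluster r))) //= eqxx mul1r big1 ?addr0 //.
  by move=> T; rewrite eq_sym => /negPf->; rewrite mul0r.
rewrite big1 => [|T _]; last by rewrite mul0r.
apply: run_bad0 => [|v x]; last by rewrite at_age_ge ?age_ge.
apply: contra nb => bs; rewrite inE e0_valid /= e0_star.
by apply: badS bs => v vc; right; rewrite /= e0_age.
Qed.

Lemma psi_g_split :
  \sum_t psi t * g t = \sum_T \sum_t psi t * tree_sum T t.
Proof.
rewrite (sum_run (leqnn N)) exchange_big /=.
under eq_bigr do rewrite mulr_sumr.
rewrite exchange_big /=; apply: eq_bigr => t _.
rewrite -mulr_sumr exchange_big /= mulr_sumr; apply: eq_bigr => r _.
rewrite mulrCA; congr (_ * _); rewrite -mulr_sumr; congr (_ * _).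
exact: run_split.
Qed.

(** For a small tree the sum does not depend on the initial state, and [psi] sums to exactly 1. For
    a large one absolute values of [psi] are taken, and the oldest ages cost [M ^+ (3 * n)]. *)
Lemma psi_tree_le T : `|\sum_t psi t * tree_sum T t| <= (two_tree e0 adj T)%:R *
  (y ^+ #|T| * (if (m0 <= #|T|)%N then (\sum_t `|psi t|) * M ^+ (3 * n) else 1)).
Proof.
have [t0 _|none] := pickP (@predT state); last first.
  by move/eqP: psi_sum1; rewrite big_pred0 // eq_sym oner_eq0.
have M1 := M_ge1 t0; have N0 := Nn_ge0 t0; have M0 := le_trans ler01 M1.
pose e := (expo * #|T| + (if (m0 <= #|T|)%N then 3 * n else 0))%N.
have le t : `|tree_sum T t| <= (two_tree e0 adj T)%:R * (Nn ^+ #|T| * M ^+ e).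
  apply: (le_trans (tree_sum_le T t)); rewrite !ler_wpM2l ?exprn_ge0 //.
  rewrite ler_weXn2l // (leq_trans (card_revealed T)) // leq_add2r.
  by rewrite leq_mul2r expo_ge orbT.
have eE : Nn ^+ #|T| * M ^+ e = y ^+ #|T| * M ^+ (if (m0 <= #|T|)%N then 3 * n else 0)%N.
  by rewrite /e exprD mulrA exprM -exprMn.
case: leqP => mT in eE le *.
  apply: (@le_trans _ _ (\sum_t `|psi t| * ((two_tree e0 adj T)%:R * (Nn ^+ #|T| * M ^+ e)))).
    apply: (le_trans (ler_norm_sum _ _ _)); apply: ler_sum => t _.
    by rewrite normrM ler_wpM2l.
  rewrite -mulr_suml eE le_eqVlt; apply/orP; left; apply/eqP; ring.
rewrite (eq_bigr (fun t => psi t * tree_sum T t0)) => [|t _]; last first.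
  by congr (_ * _); apply: tree_sum_const.
by rewrite -mulr_suml psi_sum1 mul1r; apply: (le_trans (le t0)); rewrite eE expr0.
Qed.

(** A tree weighs at most [(q / 4) ^ #|T|], where the [q ^ #|T|] sum to at most 1 by percolation.
    The rest is at most [1/4] since a tree contains [e0], and at most [4^-1 ^+ m0] for a large
    tree. *)
Lemma scan_bound :
  `|\sum_t psi t * g t| <= 4^-1 + (\sum_t `|psi t|) * M ^+ (3 * n) * 4^-1 ^+ m0.
Proof.
have [t0 _|none] := pickP (@predT state); last first.
  by move/eqP: psi_sum1; rewrite big_pred0 // eq_sym oner_eq0.
have M0 := le_trans ler01 (M_ge1 t0); have N0 := Nn_ge0 t0.
set X := (\sum_t _) * _.
have X0 : 0 <= X by rewrite mulr_ge0 ?exprn_ge0 ?sumr_ge0.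
have y0 : 0 <= y by rewrite mulr_ge0 ?exprn_ge0.
set bnd := 4^-1 + _.
have d0 : 0 < d%:R :> C by rewrite ltr0n d_gt0.
pose p : C := (2 * d%:R)^-1; pose q : C := p * (1 - p) ^+ d.
have p01 : 0 <= p <= 1.
  rewrite /p invr_ge0 mulr_ge0 ?ler0n //= invf_le1 ?mulr_gt0 //.
  by rewrite (le_trans (_ : 1 <= 2)) ?ler1n // ler_peMr ?ler1n ?d_gt0.
have q4 : y <= q * 4^-1.
  by rewrite ler_pdivlMr ?ltr0n // mulrC; apply: tree_weight_le.
have q0 : 0 <= q by case/andP: p01 => ? ?; rewrite mulr_ge0 ?exprn_ge0 ?subr_ge0.
have h4 : 0 <= 4^-1 :> C by rewrite invr_ge0 ler0n.
have bnd0 : 0 <= bnd by exact: addr_ge0 h4 (mulr_ge0 X0 (exprn_ge0 _ h4)).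
rewrite psi_g_split; apply: (le_trans (ler_norm_sum _ _ _)).
apply: (@le_trans _ _ (\sum_(T | cluster e0 (adj2 adj) T == T) q ^+ #|T| * bnd)).
  rewrite [leRHS]big_mkcond; apply: ler_sum => T _.
  apply: (le_trans (psi_tree_le T)); rewrite /two_tree.
  case: eqP => TE; last by rewrite mul0r.
  have e0T : e0 \in T by rewrite -TE cluster_root.
  have T0 : (0 < #|T|)%N by apply/card_gt0P; exists e0.
  apply: (@le_trans _ _ (y ^+ #|T| * (if (m0 <= #|T|)%N then X else 1))).
    case: (independent _ _); rewrite ?mul1r // mul0r.
    by rewrite mulr_ge0 ?exprn_ge0 //; case: ifP.
  apply: (@le_trans _ _ ((q * 4^-1) ^+ #|T| * (if (m0 <= #|T|)%N then X else 1))).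
    apply: ler_wpM2r; first by case: ifP.
    by apply: lerXn2r; rewrite ?nnegrE //; apply: mulr_ge0.
  rewrite exprMn -mulrA ler_wpM2l ?exprn_ge0 //.
  have h41 : 4^-1 <= 1 :> C by rewrite invf_le1 ?ler1n ?ltr0n.
  case: leqP => mT.
    rewrite mulrC (le_trans (_ : _ <= X * 4^-1 ^+ m0)) ?ler_wpM2l ?ler_wiXn2l //.
    by rewrite /bnd lerDr.
  rewrite mulr1 (le_trans (_ : _ <= 4^-1 ^+ 1)) ?ler_wiXn2l // expr1.
  by rewrite /bnd lerDl mulr_ge0 ?exprn_ge0.
rewrite -mulr_suml -[leRHS]mul1r ler_wpM2r //.
by apply: sum_clusters p01 _ => x; apply: card_adj2.
Qed.

End Chain.

Lemma scan_estimate (C : numFieldType) (V A I : finType) (scope : I -> {set V})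
    (J : I -> finType) (vio : forall c, pred (J c)) (pat : forall c, J c -> V -> A)
    (D : {set I}) (cstar : I) (K : V -> {ffun V -> A} -> A -> C) (g : {ffun V -> A} -> C)
    (k Delta : nat) (b : V -> option A -> C) (psi : {ffun V -> A} -> C) (Rb : V -> C)
    (M Nn : C) (expo : nat) (d := ((Delta * k ^ 2) ^ 2)%N) :
  (forall u t t', local_agree scope vio pat D [set u] [set u] t t' -> K u t =1 K u t') ->
  (forall u t, \sum_x K u t x = 1) ->
  (forall t t', local_agree scope vio pat D set0 (scope cstar) t t' -> g t = g t') ->
  (forall t, ~~ bad scope vio pat cstar (conceal set0 t) -> g t = 0) ->
  (forall t, `|g t| <= 1) ->
  cstar \in D -> (0 < k)%N -> (forall c, c \in D -> #|scope c| = k) ->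
  (forall v, #|[set c in D | v \in scope c]| <= Delta)%N ->
  (forall u, \sum_o b u o = 1) ->
  \sum_t psi t = 1 ->
  (forall u h, \sum_t psi t * h t = \sum_t psi t * \sum_o b u o * step K u o h t) ->
  (forall u t, `|b u None| * \sum_x `|K u t x| <= Rb u) ->
  (forall u, \sum_o cost b Rb u o <= M) ->
  (forall c, c \in D -> \sum_(j : J c | vio c j)
     \prod_(v in scope c) (cost b Rb v (Some (pat c j v)) + Rb v) <= Nn) ->
  (d * k <= expo)%N -> 16 * d%:R * (Nn * M ^+ expo) <= 1 ->
  forall m0,
  `|\sum_t psi t * g t| <= 4^-1 + (\sum_t `|psi t|) * M ^+ (3 * #|V|) * 4^-1 ^+ m0.
Proof.
move=> K_local K_sum1 g_local g_bad g_le1 cstarD k_gt0 scope_card degree b1 psi1 stat.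
move=> Kb Mb Nb le_expo small m0.
have /card_gt0P[v0 v0c] : (0 < #|scope cstar|)%N by rewrite scope_card.
have [|s [/= sn sc sage]] := canonical_window v0 0 (scope := scope) (c := cstar).
  by apply/set0Pn; exists v0.
pose N := (#|V| * (2 * m0 + 6))%N.
have n0 : (0 < #|V|)%N by apply/card_gt0P; exists v0.
have nN : (s + #|V| <= N)%N.
  apply: (@leq_trans (#|V| * 2)); first by rewrite muln2 -addnn leq_add2r ltnW.
  by rewrite leq_mul2l [(2 * m0 + 6)%N]addnC orbT.
have sN : (s < N)%N by apply: leq_trans nN; rewrite -[ltnLHS]addn0 ltn_add2l.
have e0_valid : valid v0 scope D ((cstar, Ordinal sN) : instance I N).
  by rewrite /valid cstarD sc.
exact: (@scan_bound C V A I v0 scope J vio pat D cstar K g K_local K_sum1 g_local g_bad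
  g_le1 N k Delta m0 cstarD k_gt0 scope_card degree erefl _ e0_valid erefl sn sage
  b psi Rb M Nn b1 psi1 stat Kb Mb Nb expo le_expo small).
Qed.
(** * Local agreement *)

Section LocalAgreement.

Variables (V A I : finType) (scope : I -> {set V}) (J : I -> finType).
Variables (vio : forall c, pred (J c)) (pat : forall c, J c -> V -> A).
Variables (D : {set I}) (U W0 : {set V}).

Local Notation state := {ffun V -> A}.
Local Notation bad := (bad scope vio pat).
Local Notation local_agree := (local_agree scope vio pat D U W0).
Implicit Types t : state.

Lemma local_agree_refl t : local_agree t t.
Proof. by exists setT; split=> // *; rewrite ?subsetT //; left. Qed.

Lemma local_agree_sym t t' : local_agree t t' -> local_agree t' t.
Proof.
move=> [W [W0W WE Wc]]; exists W; split=> // [v vW vU|c cD /(Wc _ cD)[cW|[nb nb']]].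
- by rewrite WE.
- by left.
by right.
Qed.

Lemma bad_conceal_agree c t t' (W : {set V}) : scope c \subset W ->
  {in W, forall v, v \notin U -> t v = t' v} ->
  bad c (conceal U t) -> bad c (conceal U t').
Proof.
move=> /subsetP cW WE; apply: badS => v vc; right.
by rewrite /conceal; case: ifPn => // vU; rewrite WE ?cW.
Qed.

(** Intersect the two witnesses. If a constraint lies inside only one of them, the two states
    compared there agree on it, which carries non-badness over to the outer state. *)
Lemma local_agree_trans t t' t'' :
  local_agree t t' -> local_agree t' t'' -> local_agree t t''.
Proof.
move=> [W [W0W WE Wc]] [W' [W0W' WE' Wc']]; exists (W :&: W'); split.
- by rewrite subsetI W0W.
- by move=> v /setIP[vW vW'] vU; rewrite WE ?WE'.
move=> c cD /pred0Pn[v /andP[/= vc /setIP[vW vW']]].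
have [|cW|[nt nt']] := Wc c cD.
- by apply/pred0Pn; exists v; rewrite /= vc.
- have [|cW'|[nt' nt'']] := Wc' c cD.
  + by apply/pred0Pn; exists v; rewrite /= vc.
  + by left; rewrite subsetI cW.
  + by right; split=> //; apply: contra nt'; apply: bad_conceal_agree cW WE.
have [|cW'|[_ nt'']] := Wc' c cD.
- by apply/pred0Pn; exists v; rewrite /= vc.
- right; split=> //; apply: contra nt'; apply: (bad_conceal_agree cW').
  by move=> w wW' wU; rewrite WE'.
by right.
Qed.

Variable good : pred state.

(* Extends quantities defined on the good states to all states: a state is
   given the value of a good state that agrees with it locally, if any. *)
Definition representative t : option state :=
  [pick t' | good t' && `[< local_agree t t' >]].

Lemma representative_local t t' :
  local_agree t t' -> representative t = representative t'.
Proof.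
move=> tt'; apply: eq_pick => t'' /=; congr (_ && _); apply/asboolP/asboolP.
  by apply: local_agree_trans; apply: local_agree_sym.
exact: local_agree_trans.
Qed.

Lemma representative_some t t' :
  representative t = Some t' -> good t' /\ local_agree t t'.
Proof. by rewrite /representative; case: pickP => // ? /andP[? /asboolP ?] [<-]. Qed.

Lemma representative_good t : good t ->
  exists t', [/\ representative t = Some t', good t' & local_agree t t'].
Proof.
move=> gt; case E: (representative t) => [t'|].
  by have [? ?] := representative_some E; exists t'.
move: E; rewrite /representative; case: pickP => // /(_ t).
by rewrite gt /=; move/asboolP; case; apply: local_agree_refl.
Qed.

End LocalAgreement.

Lemma sum_option (C : nmodType) (A : finType) (F : option A -> C) :
  \sum_o F o = F None + \sum_x F (Some x).
Proof.
rewrite (bigD1 None) //=; congr (_ + _).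
rewrite (reindex_omap Some id) => [|[x|] //].
by apply: eq_bigl => x; rewrite eqxx.
Qed.

Lemma sum_prod_dffun (C : comPzSemiRingType) (V : finType) (T : V -> finType)
    (F : forall v, T v -> C) :
  \sum_(s : {dffun forall v, T v}) \prod_v F v (s v) = \prod_v \sum_(a : T v) F v a.
Proof.
rewrite (reindex (@dffun_of_fprod V T)); last exact/onW_bij/dffun_of_fprod_bij.
transitivity (\sum_(t : fprod T) \prod_v [ffun a => F v a] (t v)).
  by apply: eq_bigr => t _; apply: eq_bigr => v _; rewrite !ffunE.
rewrite (big_fprod _ _ (fun v => [ffun a => F v a])) /=.
rewrite -(bigA_distr_big_dep (tagged_with T)
  (fun v => untag 0 [ffun a => F v a])); apply: eq_bigr => v _.
by rewrite -(big_tag (fun v a => [ffun a => F v a] a)); apply: eq_bigr => a _; rewrite ffunE.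
Qed.

(** * Projected measures of a formula *)

Section Formula.

Variables (R : realType) (V : finType) (Q : V -> finType).
Variables (A : finType) (Sig : V -> {set A}).
Variables (f : forall v, Q v -> symbol Sig v) (one : A) (lambda : R[i]).
Implicit Types (c : constraint Q) (s : assignment Q) (u v : V).
Local Notation C := R[i].
Local Notation state := {ffun V -> A}.
Local Notation normc := Normc.normc.
Local Notation restrict := Defs.restrict.

(** [project] without its dependent types, so that the chain runs on plain functions. *)
Definition symbols s : state := [ffun v => val (f (s v))].

(** Off the scope [one] is a default that [bad] never reads. *)
Definition pattern c (j : passignment Q (vbl c)) v : A :=
  if insub v is Some w then val (f (j w)) else one.

Definition is_violating c : pred (passignment Q (vbl c)) := [pred j | j \in violating c].

Local Notation bad := (bad (@vbl V Q) is_violating pattern).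

Definition violated c s := restrict (vbl c) s \in violating c.

Lemma solutionsP (D : {set constraint Q}) s :
  reflect (forall c, c \in D -> ~~ violated c s) (s \in solutions D).
Proof. by rewrite inE; apply: forall_inP. Qed.

Lemma violated_bad c s U : violated c s -> bad c (conceal U (symbols s)).
Proof.
move=> vs; apply/existsP; exists (restrict (vbl c) s); apply/andP; split=> //.
apply/forall_inP => v vc; rewrite /conceal; case: ifP => //= _.
by rewrite /pattern insubT ffunE /= ffunE.
Qed.

Lemma eq_violated c s s' : {in vbl c, forall v, s v = s' v} ->
  violated c s = violated c s'.
Proof.
move=> ss'; rewrite /violated; suff -> : restrict (vbl c) s = restrict (vbl c) s' by [].
by apply/ffunP => w; rewrite !ffunE ss' // (valP w).
Qed.

Definition symbols_weight (t : state) : C := lambda ^+ #|[set v | t v == one]|.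

Lemma weightE s : weight f one lambda s = symbols_weight (symbols s).
Proof.
rewrite /weight /symbols_weight; congr (_ ^+ #|pred_of_set _|).
by apply/setP => v; rewrite !inE ffunE.
Qed.

Lemma symbols_weight_prod t : symbols_weight t = \prod_v (if t v == one then lambda else 1).
Proof.
by rewrite /symbols_weight -big_mkcond /= -prodr_const; apply: eq_bigl => v; rewrite inE.
Qed.

Definition splice_assignment (W : {set V}) s s' : assignment Q :=
  [ffun v => if v \in W then s v else s' v].

Lemma splice_assignmentK W s s' :
  splice_assignment W (splice_assignment W s s') (splice_assignment W s' s) = s.
Proof. by apply/ffunP => v; rewrite !ffunE; case: ifP => // ->. Qed.

Lemma symbols_splice W s s' :
  symbols (splice_assignment W s s') = splice (mem W) (symbols s) (symbols s').
Proof. by apply/ffunP => v; rewrite !ffunE; case: ifP. Qed.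

Variable D : {set constraint Q}.

Definition fibre_sum (h : assignment Q -> C) (t : state) : C :=
  \sum_(s in solutions D | symbols s == t) weight f one lambda s * h s.

Definition fibre_total := fibre_sum (fun=> 1).

Lemma fibre_sumE h t :
  fibre_sum h t = symbols_weight t * \sum_(s in solutions D | symbols s == t) h s.
Proof.
rewrite /fibre_sum mulr_sumr; apply: eq_bigr => s /andP[_ /eqP <-].
by rewrite weightE.
Qed.

(** Exchange the parts in [W] of a solution above [t] and one above [t']. Constraints inside [W] or
    disjoint from it are only passed between the two assignments, and crossing ones hold in all
    four; the product of the weights is unchanged. *)
Lemma fibre_sum_swap (W : {set V}) (h : assignment Q -> C) t t' :
  (forall s s', {in W, forall v, s v = s' v} -> h s = h s') ->
  (forall c, c \in D -> ~~ [disjoint vbl c & W] -> vbl c \subset W \/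
     [/\ ~~ bad c (conceal set0 t), ~~ bad c (conceal set0 t'),
         ~~ bad c (conceal set0 (splice (mem W) t t')) &
         ~~ bad c (conceal set0 (splice (mem W) t' t))]) ->
  fibre_sum h t * fibre_total t' =
  fibre_sum h (splice (mem W) t t') * fibre_total (splice (mem W) t' t).
Proof.
move=> hW Wc; rewrite /fibre_total !fibre_sumE mulrACA [RHS]mulrACA; congr (_ * _).
  rewrite !symbols_weight_prod -!big_split /=; apply: eq_bigr => v _.
  by rewrite !ffunE; case: (_ \in _) => //; rewrite mulrC.
have mkcond h' x : \sum_(s in solutions D | symbols s == x) h' s =
    \sum_s (if (s \in solutions D) && (symbols s == x) then h' s else 0) :> C.
  exact: big_mkcond.
rewrite !mkcond !big_distrlr /=.
rewrite [RHS](sum_swap _ (splice_assignmentK W)).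
apply: eq_bigr => s _; apply: eq_bigr => s' _.
have simE : (symbols (splice_assignment W s s') == splice (mem W) t t') &&
    (symbols (splice_assignment W s' s) == splice (mem W) t' t) =
    (symbols s == t) && (symbols s' == t').
  rewrite !symbols_splice; apply/andP/andP => -[/eqP e1 /eqP e2].
    by rewrite -(spliceK (mem W) (symbols s) (symbols s')) e1 e2 spliceK
       -(spliceK (mem W) (symbols s') (symbols s)) e1 e2 spliceK !eqxx.
  by rewrite e1 e2.
have hE : h (splice_assignment W s s') = h s.
  by apply: hW => v vW; rewrite ffunE vW.
have [/andP[/eqP e1 /eqP e2]|ne] := boolP ((symbols s == t) && (symbols s' == t')); last first.
  have -> x y : (if (s \in solutions D) && (symbols s == t) then x else 0) *
      (if (s' \in solutions D) && (symbols s' == t') then y else 0) = 0 :> C.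
    by move: ne; rewrite negb_and => /orP[]/negPf->; rewrite andbF ?mul0r ?mulr0.
  rewrite -simE in ne.
  by move: ne; rewrite negb_and => /orP[]/negPf->; rewrite andbF ?mul0r ?mulr0.
have := simE; rewrite e1 e2 !eqxx => /andP[/[dup] /eqP e3 -> /[dup] /eqP e4 ->].
rewrite !andbT hE.
have solE : (s \in solutions D) && (s' \in solutions D) =
    (splice_assignment W s s' \in solutions D) && (splice_assignment W s' s \in solutions D).
  have cE c : c \in D -> violated c s || violated c s' =
      violated c (splice_assignment W s s') || violated c (splice_assignment W s' s).
    move=> cD; have [dis|ndis] := boolP [disjoint vbl c & W].
      rewrite orbC; congr (_ || _); apply: eq_violated => v vc; rewrite ffunE.
        by rewrite (disjointFr dis vc).
      by rewrite (disjointFr dis vc).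
    have [cW|[n1 n2 n3 n4]] := Wc c cD ndis.
      by congr (_ || _); apply: eq_violated => v vc; rewrite ffunE (subsetP cW).
    have nv x y : symbols x = y -> ~~ bad c (conceal set0 y) -> violated c x = false.
      by move=> <- nb; apply: contraNF nb; apply: violated_bad.
    by rewrite (nv _ _ e1 n1) (nv _ _ e2 n2) (nv _ _ e3 n3) (nv _ _ e4 n4).
  apply/andP/andP => -[/solutionsP h1 /solutionsP h2]; split; apply/solutionsP => c cD.
  - have := cE c cD; rewrite (negPf (h1 c cD)) (negPf (h2 c cD)) /=.
    by move/esym/negbT; rewrite negb_or => /andP[].
  - have := cE c cD; rewrite (negPf (h1 c cD)) (negPf (h2 c cD)) /=.
    by move/esym/negbT; rewrite negb_or => /andP[].
  - have := cE c cD; rewrite (negPf (h1 c cD)) (negPf (h2 c cD)) /=.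
    by move/negbT; rewrite negb_or => /andP[].
  - have := cE c cD; rewrite (negPf (h1 c cD)) (negPf (h2 c cD)) /=.
    by move/negbT; rewrite negb_or => /andP[].
move: solE; do 4 case: (_ \in solutions D); rewrite ?mulr0 ?mul0r //.
Qed.

Hypothesis Z_neq0 : Z f one lambda D != 0.

Local Notation psi := (psi f one lambda D).
Local Notation psi_on := (psi_on f one lambda D).
Local Notation psi_cond := (psi_cond f one lambda D).
Local Notation extendable := (extendable f one lambda D).
Local Notation weight := (weight f one lambda).
Local Notation ZD := (Z f one lambda D).

Definition density (t : state) : C := fibre_total t / ZD.

Lemma sum_fibre h : \sum_t fibre_sum h t = \sum_(s in solutions D) weight s * h s.
Proof. by rewrite (partition_big symbols xpredT). Qed.

Lemma density_sum1 : \sum_t density t = 1.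
Proof.
rewrite -mulr_suml sum_fibre; under eq_bigr do rewrite mulr1.
exact: mulfV.
Qed.

(** [density], [slice] and [cond] are [psi], [psi_on] and [psi_cond] read on plain states. *)
Definition slice u (t : state) : C := \sum_x density (upd t u x).

Definition cond u (t : state) (x : A) : C := density (upd t u x) / slice u t.

Lemma updE (t : state) u x s :
  (symbols s == upd t u x) =
  [forall v, (v != u) ==> (symbols s v == t v)] && (symbols s u == x).
Proof.
apply/eqP/andP => [->|[/forallP h /eqP su]].
  split; last by rewrite ffunE eqxx.
  by apply/forallP => v; apply/implyP => /negPf vu; rewrite ffunE vu.
apply/ffunP => v; rewrite [RHS]ffunE; case: eqP => [->//|/eqP vu].
by apply/eqP; have := h v; rewrite vu.
Qed.

Lemma slice_sum u t : slice u t =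
  (\sum_(s in solutions D | [forall v, (v != u) ==> (symbols s v == t v)]) weight s) / ZD.
Proof.
rewrite /slice /density -mulr_suml; congr (_ / _).
rewrite [RHS](partition_big (fun s => symbols s u) xpredT) //=.
apply: eq_bigr => x _; rewrite /fibre_total /fibre_sum.
by apply: eq_big => [s|s _]; rewrite ?mulr1 // updE andbA.
Qed.

Lemma sum_psi (P : pred (assignment (symbol Sig))) :
  \sum_(t' | P t') psi t' = (\sum_(s in solutions D | P (project f s)) weight s) / ZD.
Proof.
rewrite (partition_big (project f) P) => [|s /andP[]//].
rewrite mulr_suml; apply: eq_bigr => t' Pt'; rewrite mulr_suml.
apply: eq_bigl => s; rewrite -andbA; congr (_ && _).
by case: eqP => [->|]; rewrite ?Pt' ?andbF.
Qed.

Lemma project_eq s s' v : (project f s v == project f s' v) = (symbols s v == symbols s' v).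
Proof. by rewrite /project /symbols !ffunE val_eqE. Qed.

Lemma psi_project s : psi (project f s) = density (symbols s).
Proof.
have := sum_psi (pred1 (project f s)); rewrite big_pred1_eq => ->.
rewrite /density /fibre_total /fibre_sum; congr (_ / _).
apply: eq_big => [s'|s' _]; last by rewrite mulr1.
congr (_ && _); apply/eqP/eqP => e; apply/ffunP => v; apply/eqP.
  by rewrite -project_eq e.
by rewrite project_eq e.
Qed.

Lemma restrict_project u s s' :
  (restrict [set~ u] (project f s) == restrict [set~ u] (project f s')) =
  [forall v, (v != u) ==> (symbols s v == symbols s' v)].
Proof.
apply/eqP/forallP => [e v|h]; first apply/implyP => vu.
  have vL : v \in [set~ u] by rewrite !inE.
  rewrite -project_eq; apply/eqP.
  have := congr1 (fun g : passignment (symbol Sig) [set~ u] => g (exist _ v vL)) e.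
  by rewrite /Defs.restrict /= !ffunE.
apply/ffunP => w; rewrite /Defs.restrict [LHS]ffunE [RHS]ffunE; apply/eqP.
have := h (val w); rewrite -project_eq.
by have := valP w; rewrite !inE => ->.
Qed.

Lemma density_neq0 t : density t != 0 -> exists2 s, s \in solutions D & symbols s = t.
Proof.
move=> d0; have [/existsP[s /andP[sD /eqP st]]|/existsPn none] :=
    boolP [exists s, (s \in solutions D) && (symbols s == t)]; first by exists s.
move: d0; rewrite /density /fibre_total /fibre_sum big_pred0 ?mul0r ?eqxx //.
by move=> s; apply/negbTE/none.
Qed.

Lemma density_extendable u t x : density (upd t u x) != 0 ->
  exists tt, [/\ tt \in extendable [set~ u], psi_on tt = slice u t &
    forall y, psi_cond tt y = cond u t (val y)].
Proof.
move=> d0; have [s sD sE] := density_neq0 d0.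
exists (restrict [set~ u] (project f s)).
have st v : v != u -> symbols s v = t v.
  by move=> /negPf vu; rewrite sE ffunE vu.
have cE s' : [forall v, (v != u) ==> (symbols s' v == symbols s v)] =
             [forall v, (v != u) ==> (symbols s' v == t v)].
  by apply: eq_forallb => v; case: (boolP (v != u)) => //= vu; rewrite st.
have onE : psi_on (restrict [set~ u] (project f s)) = slice u t.
  rewrite /Defs.psi_on sum_psi slice_sum; congr (_ / _).
  by apply: eq_bigl => s'; rewrite restrict_project cE.
split=> //.
  rewrite inE; apply/existsP; exists (project f s).
  by rewrite eqxx psi_project sE.
move=> y; rewrite /Defs.psi_cond onE /cond; congr (_ / _).
rewrite (sum_psi (fun t' => (restrict [set~ u] t' == _) && (t' u == y))).
rewrite /density /fibre_total /fibre_sum; congr (_ / _).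
apply: eq_big => [s'|s' _]; last by rewrite mulr1.
rewrite updE restrict_project cE; congr (_ && (_ && _)).
by rewrite !ffunE.
Qed.

Hypothesis well_defined : forall u (t : passignment (symbol Sig) [set~ u]),
  t \in extendable [set~ u] -> psi_on t != 0.

Lemma slice_neq0 u t : density t != 0 -> slice u t != 0.
Proof.
have tE : upd t u (t u) = t by apply/ffunP => v; rewrite ffunE; case: eqP => [->|].
by rewrite -{1}tE => /density_extendable[tt [/well_defined + <- _]].
Qed.

Lemma slice_extendable u t : slice u t != 0 ->
  exists2 tt, tt \in extendable [set~ u] & forall y, psi_cond tt y = cond u t (val y).
Proof.
move=> s0; have [/existsP[x d0]|/existsPn none] := boolP [exists x, density (upd t u x) != 0].
  by have [tt [? _ ?]] := density_extendable d0; exists tt.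
move: s0; rewrite /slice big1 ?eqxx // => x _.
by apply/eqP; have := none x; rewrite negbK.
Qed.

Lemma cond_sum1 u t : slice u t != 0 -> \sum_x cond u t x = 1.
Proof. by move=> s0; rewrite -mulr_suml mulfV. Qed.

Lemma cond_notin u t x : x \notin Sig u -> cond u t x = 0.
Proof.
move=> xS; rewrite /cond; suff -> : density (upd t u x) = 0 by rewrite mul0r.
apply/eqP; apply: contraNT xS => /density_neq0[s _ /ffunP/(_ u)].
by rewrite !ffunE eqxx => <-; apply: valP.
Qed.

Variables (D0 : {set constraint Q}) (cstar : constraint Q).
Hypothesis DE : D = D0 :\ cstar.
Hypothesis cstarD : cstar \in D0.

Local Notation local_agree := (local_agree (@vbl V Q) is_violating pattern D0).

Lemma sub_D0 c : c \in D -> c \in D0. Proof. by rewrite DE => /setD1P[]. Qed.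

Lemma bad_conceal c (U U' : {set V}) (t t' : state) : U \subset U' ->
  (forall v, v \notin U' -> t v = t' v) -> ~~ bad c (conceal U' t') -> ~~ bad c (conceal U t).
Proof.
move=> /subsetP UU' tt'; apply: contra; apply: badS => v _; rewrite /conceal.
case: (boolP (v \in U')) => [|vU']; first by left.
by right; rewrite tt' //; case: ifP => // /UU'; rewrite (negPf vU').
Qed.

(** The witness [W] contains [u], and off [u] the two states agree on it, so exchanging the parts in
    [W] just exchanges [x] and [y]. *)
Lemma density_swap u t t' x y : local_agree [set u] [set u] t t' ->
  density (upd t u x) * density (upd t' u y) =
  density (upd t u y) * density (upd t' u x).
Proof.
move=> [W [uW WE Wc]]; rewrite sub1set in uW.
have e1 : splice (mem W) (upd t u x) (upd t' u y) = upd t' u x.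
  apply/ffunP => v; rewrite !ffunE; case: eqP => [->|/eqP vu]; first by rewrite uW.
  by case: ifP => // vW; apply: WE => //; rewrite inE.
have e2 : splice (mem W) (upd t' u y) (upd t u x) = upd t u y.
  apply/ffunP => v; rewrite !ffunE; case: eqP => [->|/eqP vu]; first by rewrite uW.
  by case: ifP => // vW; rewrite WE // inE.
rewrite /density mulrACA [RHS]mulrACA; congr (_ * _).
have offu z (r : state) v : v \notin [set u] -> upd r u z v = r v.
  by rewrite inE ffunE => /negPf->.
rewrite {1}/fibre_total (fibre_sum_swap (W := W)) //; last first.
  move=> c cD nd; have [|[nb nb']] := Wc c (sub_D0 cD) nd; first by left.
  rewrite e1 e2; right.
  by split; (apply: (bad_conceal (sub0set [set u]));
    [exact: offu | first [exact: nb | exact: nb']]).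
by rewrite e1 e2 mulrC.
Qed.

Lemma cond_local u t t' : local_agree [set u] [set u] t t' ->
  slice u t != 0 -> slice u t' != 0 -> cond u t =1 cond u t'.
Proof.
move=> tt' s0 s0' x; rewrite /cond; apply/eqP; rewrite eqr_div //; apply/eqP.
rewrite /slice !mulr_sumr; apply: eq_bigr => y _.
by rewrite density_swap // mulrC.
Qed.

Definition violation s : C := (violated cstar s)%:R.

(** The states agree on [W], so the exchange of the parts in [W] turns one into the other. *)
Lemma violation_local t t' : local_agree set0 (vbl cstar) t t' ->
  fibre_sum violation t * fibre_total t' = fibre_total t * fibre_sum violation t'.
Proof.
move=> [W [cW WE Wc]].
have tt' v : v \in W -> t v = t' v by move=> vW; apply: WE; rewrite ?inE.
have e1 : splice (mem W) t t' = t'.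
  by apply/ffunP => v; rewrite !ffunE; case: ifP => // /tt'.
have e2 : splice (mem W) t' t = t.
  by apply/ffunP => v; rewrite !ffunE; case: ifP => // /tt'.
rewrite (fibre_sum_swap (W := W)); last 2 first.
- move=> s s' ss'; rewrite /violation (@eq_violated _ _ s') // => v vc.
  by apply: ss'; apply: (subsetP cW).
- move=> c cD nd; have [|[nb nb']] := Wc c (sub_D0 cD) nd; first by left.
  by rewrite e1 e2; right.
by rewrite e1 e2 mulrC.
Qed.

(** The complex weight is constant on a fibre and cancels, leaving a proportion of solutions; an
    empty denominator gives 0 by convention. *)
Lemma violation_le t : `|fibre_sum violation t / fibre_total t| <= 1.
Proof.
have [->|t0] := eqVneq (fibre_total t) 0; first by rewrite invr0 mulr0 normr0.
rewrite normrM normfV ler_pdivrMr ?normr_gt0 // mul1r.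
rewrite /fibre_total !fibre_sumE !normrM ler_wpM2l //.
rewrite !ger0_norm; try by apply: sumr_ge0 => s _; rewrite ?ler0n.
by apply: ler_sum => s _; rewrite /violation lern1; case: (violated _ _).
Qed.

(** No cancellation occurs inside a fibre: a zero total means weight 0 or an empty fibre. *)
Lemma violation0 t : fibre_total t = 0 -> fibre_sum violation t = 0.
Proof.
rewrite /fibre_total !fibre_sumE => /eqP; rewrite mulf_eq0 => /orP[/eqP->|].
  by rewrite mul0r.
rewrite sumr_const -mulr_natr mul1r pnatr_eq0 => /eqP c0.
by rewrite big_pred0 ?mulr0 // => s; have := card0_eq c0 s.
Qed.

Lemma violation_bad t : ~~ bad cstar (conceal set0 t) -> fibre_sum violation t = 0.
Proof.
move=> nb; rewrite /fibre_sum big1 // => s /andP[_ /eqP st].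
rewrite /violation; case: (boolP (violated cstar s)) => [|_]; last by rewrite mulr0.
by move=> /(violated_bad set0); rewrite st (negPf nb).
Qed.

(** Reversibility: exchange the old value at [u] with the resampled one. *)
Lemma glauber_stationary u (h : state -> C) :
  \sum_t density t * \sum_x cond u t x * h (upd t u x) = \sum_t density t * h t.
Proof.
under eq_bigr do rewrite mulr_sumr.
rewrite pair_bigA /= (reindex_inj (h := fun p : state * A => (upd p.1 u p.2, p.1 u))) /=.
  rewrite -(pair_bigA _ (fun t x => density (upd t u x) *
    (cond u (upd t u x) (t u) * h (upd (upd t u x) u (t u))))) /=.
  apply: eq_bigr => t _.
  have tE x : upd (upd t u x) u (t u) = t.
    by apply/ffunP => v; rewrite !ffunE; case: eqP => [->|].
  have sE x : slice u (upd t u x) = slice u t.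
    apply: eq_bigr => y _; congr density.
    by apply/ffunP => v; rewrite !ffunE; case: eqP.
  under eq_bigr => x _ do rewrite /cond tE sE.
  rewrite -mulr_suml -/(slice u t).
  have [->|d0] := eqVneq (density t) 0; first by rewrite !mul0r mulr0.
  by rewrite mulrA mulrCA mulfV ?slice_neq0 // mulr1.
apply: inv_inj => -[t x] /=; congr (_, _); last by rewrite ffunE eqxx.
by apply/ffunP => v; rewrite !ffunE; case: eqP => [->|].
Qed.

(** * Kernels and violation ratios at arbitrary states *)

Variable b : forall u, option (symbol Sig u) -> C.
Arguments b : clear implicits.
Hypothesis b_sum1 : forall u, \sum_x b u x = 1.
Hypothesis dec : decomposes f one lambda b D.

Definition extended_b u (o : option A) : C :=
  if o is Some a then oapp (fun x => b u (Some x)) 0 (insub a) else b u None.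

Lemma extended_bE u (x : symbol Sig u) : extended_b u (Some (val x)) = b u (Some x).
Proof. by rewrite /extended_b valK. Qed.

Lemma extended_b_notin u a : a \notin Sig u -> extended_b u (Some a) = 0.
Proof. by move=> aS; rewrite /extended_b insubF //; apply: negbTE. Qed.

Lemma sum_symbol (F : A -> C) u : (forall a, a \notin Sig u -> F a = 0) ->
  \sum_a F a = \sum_(x : symbol Sig u) F (val x).
Proof.
move=> F0; rewrite (bigID (mem (Sig u))) /= [X in _ + X]big1 ?addr0 //.
exact: big_sub.
Qed.

Lemma extended_b_sum1 u : \sum_o extended_b u o = 1.
Proof.
rewrite -(b_sum1 u) !sum_option (@sum_symbol _ u) /=; last exact: extended_b_notin.
by congr (_ + _); apply: eq_bigr => x _; apply: extended_bE.
Qed.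

Variable t0 : state.
Hypothesis density_t0 : density t0 != 0.

(** [t0] is a fallback that keeps the slice nonzero when no suitable state agrees locally with
    [t]. *)
Definition extendable_near u t : state := odflt t0
  (representative (@vbl V Q) is_violating pattern D0 [set u] [set u]
     (fun t' => slice u t' != 0) t).

Lemma extendable_near_neq0 u t : slice u (extendable_near u t) != 0.
Proof.
rewrite /extendable_near; case E: (representative _ _ _ _ _ _ _ _) => [t'|] /=.
  by have [] := representative_some E.
exact: slice_neq0.
Qed.

(* When [b u None = 0] the kernel only occurs with coefficient [0], and any
   distribution will do. *)
Definition kernel u t x : C :=
  if b u None == 0 then (x == one)%:R
  else (cond u (extendable_near u t) x - extended_b u (Some x)) / b u None.

Lemma kernel_local u t t' : local_agree [set u] [set u] t t' -> kernel u t =1 kernel u t'.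
Proof. by move=> tt' x; rewrite /kernel /extendable_near (representative_local _ tt'). Qed.

Lemma kernel_sum1 u t : \sum_x kernel u t x = 1.
Proof.
rewrite /kernel; case: eqVneq => [_|b0].
  by rewrite (bigD1 one) //= eqxx big1 ?addr0 // => x /negPf->.
rewrite -mulr_suml sumrB cond_sum1 ?extendable_near_neq0 //.
by rewrite -[X in X - _](extended_b_sum1 u) sum_option /= addrK mulfV.
Qed.

(** The representative of such a state has the same conditional measure by [cond_local], so the
    decomposition is exact wherever [density] has mass. *)
Lemma kernel_cond u t x : density t != 0 ->
  extended_b u (Some x) + b u None * kernel u t x = cond u t x.
Proof.
move=> d0; have s0 := slice_neq0 u d0; rewrite /kernel.
have [b0|b0] := eqVneq (b u None) 0; last first.
  have [t' [E s0' tt']] := representative_good (@vbl V Q) is_violating pattern D0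
    [set u] [set u] (good := fun t' => slice u t' != 0) s0.
  rewrite mulrC divfK // addrC subrK /extendable_near E /=.
  by rewrite -(cond_local tt').
rewrite b0 mul0r addr0; have [tt tte ttE] := slice_extendable s0.
case: (boolP (x \in Sig u)) => xS; last by rewrite extended_b_notin // cond_notin.
by rewrite -[x]/(val (exist _ x xS : symbol Sig u)) extended_bE -ttE dec.
Qed.

Lemma kernel_stationary u h : \sum_t density t * h t =
  \sum_t density t * \sum_o extended_b u o * step kernel u o h t.
Proof.
rewrite -(glauber_stationary u); apply: eq_bigr => t _.
have [->|d0] := eqVneq (density t) 0; first by rewrite !mul0r.
congr (_ * _); rewrite sum_option /= mulr_sumr -big_split /=.
by apply: eq_bigr => x _; rewrite -(kernel_cond _ _ d0) mulrDl addrC -mulrA.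
Qed.

Lemma normcE_real (x : C) : `|x| = (normc x)%:C. Proof. by []. Qed.

Lemma kernel_bound u t :
  `|b u None| * \sum_x `|kernel u t x| <= (Rbound f one lambda b D u)%:C.
Proof.
rewrite /kernel /Rbound; case: eqVneq => [->|b0]; first by rewrite normr0 mul0r.
have [tt tte ttE] := slice_extendable (extendable_near_neq0 u t).
rewrite (@sum_symbol _ u) => [|a aS]; last first.
  by rewrite cond_notin // extended_b_notin // subrr mul0r normr0.
rewrite normcE_real; under eq_bigr do rewrite normcE_real extended_bE -ttE.
rewrite -rmorph_sum -rmorphM lecR ler_wpM2l //.
  by rewrite -lecR; exact: (normr_ge0 (b u None)).
exact: (bigmax_sup tt).
Qed.

(** The function [g] of the chain, with value 0 at states without a representative. *)
Definition violation_ratio t : C :=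
  if representative (@vbl V Q) is_violating pattern D0 set0 (vbl cstar)
       (fun t' => density t' != 0) t is Some t'
  then fibre_sum violation t' / fibre_total t' else 0.

Lemma violation_ratio_local t t' : local_agree set0 (vbl cstar) t t' ->
  violation_ratio t = violation_ratio t'.
Proof. by move=> tt'; rewrite /violation_ratio (representative_local _ tt'). Qed.

Lemma violation_ratio_bad t : ~~ bad cstar (conceal set0 t) -> violation_ratio t = 0.
Proof.
move=> nb; rewrite /violation_ratio; case E: (representative _ _ _ _ _ _ _ _) => [t'|] //.
have [_ [W [cW WE _]]] := representative_some E.
rewrite violation_bad ?mul0r //; apply: contra nb.
by apply: (bad_conceal_agree cW) => v vW vU; rewrite WE.
Qed.

Lemma violation_ratio_le t : `|violation_ratio t| <= 1.
Proof.
by rewrite /violation_ratio; case: (representative _ _ _ _ _ _ _ _) => [t'|];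
  rewrite ?violation_le ?normr0.
Qed.

Lemma density_violation t : density t * violation_ratio t = fibre_sum violation t / ZD.
Proof.
have [d0|d0] := eqVneq (density t) 0.
  have X0 : fibre_total t = 0.
    by apply/eqP; move/eqP: d0; rewrite mulf_eq0 invr_eq0 (negPf Z_neq0) orbF.
  by rewrite d0 (violation0 X0) !mul0r.
have [t' [E d0' tt']] := representative_good (@vbl V Q) is_violating pattern D0
    set0 (vbl cstar) (good := fun t' => density t' != 0) d0.
have X0' : fibre_total t' != 0 by apply: contraNneq d0' => X0'; rewrite /density X0' mul0r.
rewrite /violation_ratio E /density mulrAC; congr (_ / _).
by rewrite mulrA -(violation_local tt') mulfK.
Qed.

Lemma Z_split : Z f one lambda D0 = ZD * (1 - \sum_t density t * violation_ratio t).
Proof.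
under eq_bigr do rewrite density_violation.
rewrite -mulr_suml mulrBr mulr1 mulrCA mulfV // mulr1 sum_fibre.
rewrite /Z -sumrB big_mkcond [RHS]big_mkcond /=; apply: eq_bigr => s _.
have -> : (s \in solutions D0) = (s \in solutions D) && ~~ violated cstar s.
  apply/solutionsP/andP => [h|[/solutionsP h nv] c cD].
    by split; [apply/solutionsP => c /sub_D0/h|exact: h].
  by have [->//|ne] := eqVneq c cstar; apply: h; rewrite DE !inE ne.
rewrite /violation; case: (s \in solutions D) => //=.
by case: (violated cstar s); rewrite ?mulr1 ?mulr0 ?subrr ?subr0.
Qed.

Lemma Nhat_bound c : c \in D0 ->
  \sum_(j | @is_violating c j) \prod_(v in vbl c)
    (cost extended_b (fun u => (Rbound f one lambda b D u)%:C) v (Some (@pattern c j v))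
      + (Rbound f one lambda b D v)%:C) <= (Nhat f one lambda b D0 D)%:C.
Proof.
move=> cD.
have -> : \sum_(j | @is_violating c j) \prod_(v in vbl c)
    (cost extended_b (fun u => (Rbound f one lambda b D u)%:C) v (Some (@pattern c j v))
      + (Rbound f one lambda b D v)%:C) =
  (\sum_(j in violating c) \prod_(u : {v : V | v \in vbl c})
      (normc (b (val u) (Some (f (j u)))) + Rbound f one lambda b D (val u)))%:C.
  rewrite rmorph_sum; apply: eq_bigr => j _; rewrite rmorph_prod big_sub.
  apply: eq_bigr => w _; rewrite rmorphD /= /pattern valK.
  by rewrite -/(extended_b _ (Some _)) extended_bE normcE_real.
by rewrite lecR; apply: (bigmax_sup c).
Qed.

Lemma Mhat_bound u :
  \sum_o cost extended_b (fun u => (Rbound f one lambda b D u)%:C) u o <=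
  (Mhat f one lambda b D)%:C.
Proof.
rewrite sum_option /= addrC (@sum_symbol _ u) => [|a aS]; last first.
  by rewrite -/(extended_b u (Some a)) extended_b_notin ?normr0.
under eq_bigr => x _ do rewrite -/(extended_b u (Some (val x))) extended_bE normcE_real.
by rewrite -rmorph_sum -rmorphD lecR; apply: (bigmax_sup u).
Qed.

End Formula.

(** * Adding one constraint, and the induction *)

Lemma Z_neq0_step (R : realType) (V : finType) (Q : V -> finType) (A : finType)
    (Sig : V -> {set A}) (f : forall v, Q v -> symbol Sig v) (one : A) (lambda : R[i])
    (k Delta : nat) (D : {set constraint Q}) (c : constraint Q) :
  c \in D -> (0 < k)%N -> (forall d, d \in D -> #|vbl d| = k) ->
  (forall v, #|[set d in D | v \in vbl d]| <= Delta)%N ->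
  condition_star f one lambda k Delta D c ->
  Z f one lambda (D :\ c) != 0 -> Z f one lambda D != 0.
Proof.
move=> cD k_gt0 card_vbl degree star Z0; have [wd [b [b1 dec small]]] := star Z0.
have DE : D :\ c = D :\ c by [].
have [/existsP[t0 d0]|/existsPn none] :=
    boolP [exists t, density f one lambda (D :\ c) t != 0]; last first.
  have := density_sum1 Z0; rewrite big1 => [/eqP|t _]; first by rewrite eq_sym oner_eq0.
  by apply/eqP; have := none t; rewrite negbK.
rewrite (Z_split Z0 DE cD) mulf_neq0 //.
set D' := D :\ c in wd dec small d0 DE *.
set S := \sum_t _.
have M0 : 0 <= Mhat f one lambda b D' by apply: bigmax_ge_id.
have N0 : 0 <= Nhat f one lambda b D D' by apply: bigmax_ge_id.
have le := scan_estimate (fun u t t' => @kernel_local R V Q A Sig f one lambda D' D b t0 u t t')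
  (kernel_sum1 wd D b1 d0) (fun t t' => @violation_ratio_local R V Q A Sig f one lambda D' D c t t')
  (fun t => @violation_ratio_bad R V Q A Sig f one lambda D' D c t)
  (violation_ratio_le f one lambda D' D c) cD k_gt0 card_vbl degree (extended_b_sum1 b1)
  (density_sum1 Z0) (kernel_stationary wd DE dec t0) (kernel_bound wd D b d0)
  (Mhat_bound f one lambda D' b) (fun d => @Nhat_bound R V Q A Sig f one lambda D' D b d)
  (expo := (4 * Delta ^ 2 * k ^ 5)%N) _ _.
have {le}le m : `|S| <= 4^-1 + (\sum_t `|density f one lambda D' t|) *
    ((Mhat f one lambda b D')%:C) ^+ (3 * #|V|) * 4^-1 ^+ m.
  (* With [d = Delta^2 k^4] the exponent needed is [d k = Delta^2 k^5], a quarter of the one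
     available. *)
  apply: le; first by rewrite expnMn -expnM -mulnA -expnSr -mulnA leq_pmull.
  have -> : 16 * (((Delta * k ^ 2) ^ 2)%N%:R) * ((Nhat f one lambda b D D')%:C *
      (Mhat f one lambda b D')%:C ^+ (4 * Delta ^ 2 * k ^ 5)) =
    (16 * (((Delta * k ^ 2) ^ 2)%N%:R) * (Nhat f one lambda b D D' *
      Mhat f one lambda b D' ^+ (4 * Delta ^ 2 * k ^ 5)))%:C.
    by rewrite !rmorphM rmorphXn /= !rmorph_nat.
  rewrite -[leRHS](rmorph1 (real_complex R)) lecR.
  (* The condition amounts to [16 e d X Y <= 1], and [e >= 1]. *)
  move: small; set X := Nhat _ _ _ _ _ _; set Y := _ ^+ (4 * _ * _) => small.
  have X0 : 0 <= X by [].
  have Y0 : 0 <= Y by apply: exprn_ge0.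
  have e1 : 1 <= expR 1 :> R by rewrite (le_trans _ (expR_ge1Dx 1)) // lerDl.
  rewrite expnMn -expnM natrM !natrX.
  have P0 : 0 <= Delta%:R ^+ 2 * k%:R ^+ 4 * (X * Y) by rewrite !mulr_ge0 ?exprn_ge0.
  have : Delta%:R ^+ 2 * k%:R ^+ 4 * (X * Y) <= expR 1 * (Delta%:R ^+ 2 * k%:R ^+ 4 * (X * Y)).
    by rewrite ler_peMl.
  lra.
(* If the factor vanished, [S] would be 1, whereas [|S| <= 1/4 + B 4^-m] for every [m]. Taking
   [m > 2 B] and using [m <= 4^m] bounds this by [3/4]. *)
apply/negP => /eqP/subr0_eq/esym S1.
pose B : R := (\sum_t Normc.normc (density f one lambda D' t)) *
  Mhat f one lambda b D' ^+ (3 * #|V|).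
have B0 : 0 <= B.
  rewrite mulr_ge0 ?exprn_ge0 // sumr_ge0 // => t _.
  by rewrite -lecR; exact: (normr_ge0 (density f one lambda D' t)).
have leR m : 1 <= 4^-1 + B * 4^-1 ^+ m.
  have := le m; rewrite S1 normr1.
  have -> : 4^-1 + (\sum_t `|density f one lambda D' t|) *
      (Mhat f one lambda b D')%:C ^+ (3 * #|V|) * 4^-1 ^+ m = (4^-1 + B * 4^-1 ^+ m)%:C.
    rewrite rmorphD !rmorphM !rmorphXn /= fmorphV rmorph_nat rmorph_sum.
    by [].
  by rewrite -[leLHS](rmorph1 (real_complex R)) lecR.
have [m Bm] : exists m, 2 * B < m%:R.
  by exists (Num.Def.archi_bound (2 * B)); apply: archi_boundP; rewrite mulr_ge0.
have m4 : m%:R <= 4 ^+ m :> R by rewrite -natrX ler_nat ltnW // ltn_expl.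
have p4 : 0 < 4 ^+ m :> R by apply: exprn_gt0.
have : B * 4^-1 ^+ m <= 2^-1.
  rewrite exprVn ler_pdivrMr //; move: m4 Bm; move: m%:R (4 ^+ m) => x y *; lra.
have := leR m; move: (B * _) => x *; lra.
Qed.

Theorem theorem4p6 (R : realType) (V : finType) (Q : V -> finType)
    (A : finType) (Sig : V -> {set A}) (f : forall v : V, Q v -> symbol Sig v)
    (one : A) (lambda : R[i]) (k Delta m : nat)
    (C : {set constraint Q}) (c : 'I_m -> constraint Q)
    (k_gt0 : (0 < k)%N)
    (card_vbl : forall d : constraint Q, d \in C -> #|vbl d| = k)
    (degree : forall v : V,
      (#|[set d : constraint Q in C | v \in vbl d]| <= Delta)%N)
    (c_inj : injective c)
    (c_enum : C = [set c i | i : 'I_m])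
    (Z0_neq0 : \prod_(v : V) \sum_(a : Q v)
        ((val (f v a) != one)%:R + lambda * (val (f v a) == one)%:R) != 0)
    (star : forall i : 'I_m,
      condition_star f one lambda k Delta (prefix_formula c i.+1) (c i)) :
  Z f one lambda C != 0.
Proof.
have prefix_sub i : prefix_formula c i \subset C.
  by rewrite c_enum; apply/subsetP => d /imsetP[j _ ->]; apply: imset_f.
have Zprefix i : (i <= m)%N -> Z f one lambda (prefix_formula c i) != 0.
  elim: i => [_|i IH im].
    (* Without constraints the partition function factorises over the variables into the product of
       [Z0_neq0]. *)
    have -> : prefix_formula c 0 = set0.
      by apply/setP => d; rewrite inE; apply/negbTE/imsetP => -[j]; rewrite inE.
    move: Z0_neq0; rewrite -sum_prod_dffun.
    have solE : solutions (set0 : {set constraint Q}) = [set: assignment Q].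
      by apply/setP => s; rewrite !inE; apply/forall_inP => d; rewrite inE.
    apply: contraNneq => Z0; apply/eqP; rewrite -[RHS]Z0 /Z solE.
    apply: eq_big => [s|s _]; first by rewrite inE.
    rewrite weightE symbols_weight_prod; apply: eq_bigr => v _; rewrite ffunE.
    by case: eqP => _ /=; rewrite ?mulr1 ?mulr0 ?add0r ?addr0.
  pose j := Ordinal im.
  (* Injectivity of [c] ensures that removing [c j] deletes no earlier constraint. *)
  have DE : prefix_formula c i.+1 :\ c j = prefix_formula c i.
    apply/setP => d; rewrite !inE; apply/andP/imsetP => [[dj /imsetP[l li dl]]|[l li ->]].
      exists l => //; move: li; rewrite !inE ltnS leq_eqVlt => /predU1P[li|//].
      by move: dj; rewrite dl (_ : l = j) ?eqxx //; apply: val_inj.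
    rewrite inE in li; split; last by apply: imset_f; rewrite inE ltnS ltnW.
    by apply: contraTneq li => /c_inj ->; rewrite ltnn.
  have sub := subsetP (prefix_sub i.+1).
  apply: (@Z_neq0_step _ _ _ _ _ _ _ _ k Delta _ (c j)) => //.
  - by apply: imset_f; rewrite inE.
  - by move=> d /sub/card_vbl.
  - move=> v; apply: leq_trans (degree v); apply: subset_leq_card.
    by apply/subsetP => d; rewrite !inE => /andP[/sub-> ->].
  - exact: star j.
  by rewrite DE; apply: IH; apply: ltnW.
have -> : C = prefix_formula c m; last exact: Zprefix.
rewrite c_enum; apply/setP => d; apply/imsetP/imsetP => -[j _ ->]; exists j => //.
by rewrite inE.
Qed.
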